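(* There exists a real-representable distributive lattice $E$, of cardinality $\aleph_1$, which has a homomorphic image (i.e., there is a lattice $L$ and a surjective lattice homomorphism $E\to L$) that is not Brumfiel-representable (thus also not real-representable).
   Context: A lattice-ordered ring is a ring (not necessarily unital) with a lattice ordering invariant under additive translations and preserved by multiplication by positive elements; it is an $f$-ring if for all $x,y,z\geq 0$, $x\wedge y=0$ implies $x\wedge yz=x\wedge zy=0$. An $\ell$-ideal of an $f$-ring is a ring ideal that is also an order-convex sublattice; an ideal $I$ is radical if $x^n\in I$ for some $n\ge 1$ implies $x\in I$. For a commutative $f$-ring $A$, $\operatorname{Id}^{\mathrm r}_{\mathrm c}A$ denotes the set of all finitely generated radical $\ell$-ideals of $A$ (those generated, as radical $\ell$-ideals, by finitely many elements), ordered by inclusion; it is a distributive lattice with zero. A lattice is Brumfiel-representable if it is isomorphic to $\operatorname{Id}^{\mathrm r}_{\mathrm c}A$ for some commutative $f$-ring $A$. For a commutative unital ring $R$, a cone is a subset that is both an additive and a multiplicative submonoid of $R$ and contains all squares. A cone $P$ is prime if $R=P\cup(-P)$ and $P\cap(-P)$ is a prime ideal of $R$. The real spectrum of $R$ is the set of all prime cones of $R$, with the topology generated by the sets $\{P : a\notin P\}$, $a\in R$. A lattice is real-representable if it is isomorphic to the lattice, under inclusion, of all compact (not necessarily Hausdorff) open subsets of the real spectrum of some commutative unital ring. *)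

(* Defs.v *)
From HB Require Import structures.
From mathcomp Require Import all_boot all_order all_algebra.
From mathcomp Require Import mathcomp_extra boolp classical_sets functions.
From mathcomp Require Import cardinality filter topology.

Set Implicit Arguments.
Unset Strict Implicit.
Unset Printing Implicit Defensive.

Import Order.TTheory GRing.Theory Num.Theory.

Local Open Scope classical_set_scope.
Local Open Scope card_scope.
Local Open Scope ring_scope.

(* L is isomorphic to the collection S of subsets of T, ordered by inclusion.
   The map is an order isomorphism onto S (injectivity follows from
   antisymmetry); between lattices this is the same thing as a lattice
   isomorphism, and S is automatically a lattice if such a map exists. *)
Definition isomorphic_to_family d (L : latticeType d) T (S : set (set T)) :=
  exists f : L -> set T,
    (forall x y : L, (x <= y)%O <-> f x `<=` f y) /\ range f = S.

(* aleph_1 is the least uncountable cardinal. *)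
Definition has_cardinality_aleph1 (T : Type) :=
  ~ countable [set: T] /\
  forall U : Type, ~ countable [set: U] -> [set: T] #<= [set: U].

(* Lattice-ordered rings need not be unital, so they are built over the ordered
   abelian groups of MathComp (where the order is not yet assumed to be
   translation-invariant) with a multiplication of their own. The join of
   latticeType and zmodType cannot be declared on top of MathComp's hierarchy,
   hence the operations lmeet and ljoin. *)
HB.mixin Record isLatticeOrderedRing A & Num.POrderedZmodule A := {
  lmul : A -> A -> A;
  lmulA : associative lmul;
  lmulDl : left_distributive lmul +%R;
  lmulDr : right_distributive lmul +%R;
  lmeet : A -> A -> A;
  ljoin : A -> A -> A;
  le_lmeet : forall x y z : A, (z <= lmeet x y) = (z <= x) && (z <= y);
  ljoin_le : forall x y z : A, (ljoin x y <= z) = (x <= z) && (y <= z);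
  lor_leD2r : forall z x y : A, x <= y -> x + z <= y + z;
  lor_leM2l : forall z x y : A, 0 <= z -> x <= y -> lmul z x <= lmul z y;
  lor_leM2r : forall z x y : A, 0 <= z -> x <= y -> lmul x z <= lmul y z;
}.

#[short(type="latticeOrderedRingType")]
HB.structure Definition LatticeOrderedRing :=
  {A of Num.POrderedZmodule A & isLatticeOrderedRing A}.

HB.mixin Record LatticeOrderedRing_isFRing A & LatticeOrderedRing A := {
  fring_disjoint : forall x y z : A, 0 <= x -> 0 <= y -> 0 <= z ->
    lmeet x y = 0 ->
    lmeet x (lmul y z) = 0 /\ lmeet x (lmul z y) = 0;
}.

#[short(type="fRingType")]
HB.structure Definition FRing :=
  {A of LatticeOrderedRing A & LatticeOrderedRing_isFRing A}.

HB.mixin Record FRing_isComFRing A & FRing A := {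
  lmulC : commutative (@lmul A);
}.

#[short(type="comFRingType")]
HB.structure Definition ComFRing := {A of FRing A & FRing_isComFRing A}.

Record l_ideal (A : fRingType) (I : set A) : Prop := {
  l_ideal0 : I 0;
  l_idealB : forall x y, I x -> I y -> I (x - y);
  l_idealMl : forall a x, I x -> I (lmul a x);
  l_idealMr : forall a x, I x -> I (lmul x a);
  l_ideal_meet : forall x y, I x -> I y -> I (lmeet x y);
  l_ideal_join : forall x y, I x -> I y -> I (ljoin x y);
  l_ideal_convex : forall x y z, I x -> I z -> x <= y -> y <= z -> I y;
}.

(* [iter n (lmul x) x] is the (n+1)-st power of x; there may be no unit, so
   the exponents start at 1. *)
Definition radical (A : fRingType) (I : set A) :=
  forall (x : A) (n : nat), I (iter n (lmul x) x) -> I x.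

Definition radical_l_ideal (A : fRingType) (I : set A) :=
  l_ideal I /\ radical I.

Definition fg_radical_l_ideals (A : fRingType) : set (set A) :=
  [set I | exists s : seq A, I = smallest (@radical_l_ideal A) [set` s]].

Definition brumfiel_representable d (L : latticeType d) :=
  exists A : comFRingType, isomorphic_to_family L (@fg_radical_l_ideals A).

Record cone (R : comPzRingType) (P : set R) : Prop := {
  cone0 : P 0;
  coneD : forall x y, P x -> P y -> P (x + y);
  cone1 : P 1;
  coneM : forall x y, P x -> P y -> P (x * y);
  cone_sqr : forall x, P (x ^+ 2);
}.

(* The prime ideals of ring_quotient are only available over nonzero rings. *)
Record prime_ideal (R : comPzRingType) (I : set R) : Prop := {
  prime_ideal0 : I 0;
  prime_idealD : forall x y, I x -> I y -> I (x + y);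
  prime_idealM : forall a x, I x -> I (a * x);
  prime_ideal_proper : ~ I 1;
  prime_ideal_prime : forall x y, I (x * y) -> I x \/ I y;
}.

Record prime_cone (R : comPzRingType) (P : set R) : Prop := {
  prime_cone_cone : cone P;
  prime_cone_total : [set: R] = P `|` [set - x | x in P];
  prime_cone_support : prime_ideal (P `&` [set - x | x in P]);
}.

Definition real_spectrum (R : comPzRingType) : Type :=
  {P : set R | prime_cone P}.

HB.instance Definition _ (R : comPzRingType) := gen_eqMixin (real_spectrum R).
HB.instance Definition _ (R : comPzRingType) :=
  gen_choiceMixin (real_spectrum R).

Definition real_spectrum_subbase (R : comPzRingType) :
    set (set (real_spectrum R)) :=
  [set [set P | ~ sval P a] | a in [set: R]].

HB.instance Definition _ (R : comPzRingType) :=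
  isSubBaseTopological.Build (real_spectrum R) (@real_spectrum_subbase R) id.

Definition compact_opens (T : topologicalType) : set (set T) :=
  [set U | compact U /\ open U].

Definition real_representable d (L : latticeType d) :=
  exists R : comPzRingType,
    isomorphic_to_family L (@compact_opens (real_spectrum R)).

(* Main.v *)
(* Order Z[x][y] so that x is a positive infinitesimal and y is positive and
   smaller than all powers of x. Its prime cones P0 < P1 < P2 with supports 0,
   (y) and (x, y) give points of Sper R, for R the ring of almost constant
   functions from a set W of size aleph_1 into Z[x][y]: keep P0, P1, P2 at the
   limit index, but only the copies Q0 < Q2 of P0 and P2 at each w in W. Let L
   be the lattice of traces of compact open sets on these points. Suppose that L
   comes from a commutative ring or f-ring A, and pick b1, b2 in A with b1 > 0
   exactly at P0 and b2 > 0 exactly at P0 and P1 among the limit points. Then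
   b1 <= b2 ^ n at P0 for all n. As an element of L behaves at all but finitely
   many w as it does at the limit, and W is uncountable, some w has b1, b2 > 0
   and b1 <= b2 ^ n at Q0 for all n, and b1 = b2 = 0 at Q2. Then the radical
   convex ideal generated by b1 along Q0 omits b2, which yields a cone between
   Q0 and Q2 where b1 = 0 < b2. But above w the sets b1 > 0 and b2 > 0 have the
   same trace {Q0}, so they define the same element of L. *)
Require Import Defs.
From HB Require Import structures.
From mathcomp Require Import all_boot all_order all_algebra.
From mathcomp Require Import finmap mathcomp_extra boolp classical_sets functions.
From mathcomp Require Import cardinality filter topology wochoice.

Set Implicit Arguments.
Unset Strict Implicit.
Unset Printing Implicit Defensive.

Import Order.TTheory GRing.Theory Num.Theory.

Local Open Scope classical_set_scope.
Local Open Scope card_scope.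
Local Open Scope ring_scope.

(** * Cones of nonunital commutative rings *)

Record com_rng (A : zmodType) (mul : A -> A -> A) : Prop := {
  com_rngA : associative mul;
  com_rngC : commutative mul;
  com_rngDl : left_distributive mul +%R;
}.

(** Prime cones for rings that may have no unit: properness takes the place of excluding $-1$. Since
    the cone is total, [~ N (- x)] says that [x] is strictly positive along [N], and this is how
    positivity is written throughout. *)
Record rng_cone (A : zmodType) (mul : A -> A -> A) (N : set A) : Prop := {
  rng_coneD : forall x y, N x -> N y -> N (x + y);
  rng_coneM : forall x y, N x -> N y -> N (mul x y);
  rng_cone_total : forall x, N x \/ N (- x);
  rng_cone_prime : forall x y, N x -> N y -> N (- mul x y) ->
    N (- x) \/ N (- y);
  rng_cone_proper : exists x, ~ N x;
}.

Section RngCones.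
Variables (A : zmodType) (mul : A -> A -> A).
Hypothesis rngA : com_rng mul.
Local Notation "x ** y" := (mul x y) (at level 40, left associativity).

Let mA := com_rngA rngA.
Let mC := com_rngC rngA.
Let mDl := com_rngDl rngA.
Let mDr x y z : x ** (y + z) = x ** y + x ** z.
Proof. by rewrite mC mDl mC (mC z). Qed.

Lemma rng_mul0r x : 0 ** x = 0.
Proof. by apply: (addrI (0 ** x)); rewrite -mDl !addr0. Qed.

Lemma rng_mulr0 x : x ** 0 = 0.
Proof. by rewrite mC rng_mul0r. Qed.

Lemma rng_mulNr x y : (- x) ** y = - (x ** y).
Proof. by apply: (addrI (x ** y)); rewrite -mDl !subrr rng_mul0r. Qed.

Lemma rng_mulrN x y : x ** (- y) = - (x ** y).
Proof. by rewrite mC rng_mulNr mC. Qed.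

Lemma rng_mulrnAr x y k : x ** (y *+ k) = (x ** y) *+ k.
Proof.
by elim: k => [|k ih]; rewrite ?mulr0n ?rng_mulr0 // !mulrS mDr ih.
Qed.

Lemma rng_mulACA x y z t : (x ** y) ** (z ** t) = (x ** z) ** (y ** t).
Proof. by rewrite -!mA; congr mul; rewrite !mA (mC y). Qed.

(** This is the power $x^{n+1}$, which makes sense without a unit; hence the successor in
    [rng_powD]. *)
Local Notation pow x n := (iter n (mul x) x).

Lemma rng_powM x y n : pow (x ** y) n = pow x n ** pow y n.
Proof. by elim: n => //= n ->; rewrite rng_mulACA. Qed.

Lemma rng_powD x m n : pow x m ** pow x n = pow x (m + n).+1.
Proof. by elim: m => //= m ih; rewrite -mA ih. Qed.

Lemma rng_pow_double x n : exists k, pow (x + x) n = pow x n *+ k.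
Proof.
elim: n => [|n [k ih]] /=; first by exists 2%N; rewrite mulr2n.
by exists (k + k)%N; rewrite ih mDl rng_mulrnAr mulrnDr.
Qed.

Section OneCone.
Variable N : set A.
Hypothesis coneN : rng_cone mul N.

Let ND := rng_coneD coneN.
Let NM := rng_coneM coneN.
Let NT := rng_cone_total coneN.
Let NP := rng_cone_prime coneN.

Lemma rng_cone0 : N 0.
Proof. by case: (NT 0) => //; rewrite oppr0. Qed.
Let N0 := rng_cone0.

Lemma rng_coneMn x k : N x -> N (x *+ k).
Proof. by move=> Nx; elim: k => // k ih; rewrite mulrS; apply: ND. Qed.

Lemma rng_cone_pow x n : N x -> N (pow x n).
Proof. by move=> Nx; elim: n => //= n ih; apply: NM. Qed.

Lemma rng_cone_pos x : ~ N (- x) -> N x.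
Proof. by case: (NT x). Qed.

Lemma rng_cone_trans y x z : N (y - x) -> N (z - y) -> N (z - x).
Proof. by move=> xy yz; rewrite -(subrK y z) -addrA; apply: ND. Qed.

Lemma rng_cone_cancel u x : ~ N (- u) -> N (u ** x) -> N x.
Proof.
move=> u_gt0 ux; case: (NT x) => // xn.
have := NP (rng_cone_pos u_gt0) xn; rewrite rng_mulrN !opprK.
by case/(_ ux).
Qed.

Lemma rng_cone_pow_gt0 x n : ~ N (- x) -> ~ N (- pow x n).
Proof.
move=> x_gt0; have Nx := rng_cone_pos x_gt0; elim: n => //= n ih.
by case/(NP Nx (rng_cone_pow n Nx)).
Qed.

Lemma rng_cone_le_pow x y n : N x -> N (y - x) -> N (pow y n - pow x n).
Proof.
move=> Nx Nyx; have Ny : N y by rewrite -(subrK x y); apply: ND.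
elim: n => //= n ih.
have -> : y ** pow y n - x ** pow x n =
    y ** (pow y n - pow x n) + (y - x) ** pow x n.
  by rewrite mDl mDr rng_mulNr rng_mulrN addrA subrK.
by apply: ND; apply: NM => //; apply: rng_cone_pow.
Qed.

(** * Enlarging a cone by a radical convex ideal *)

Section Hull.
Variable b : A.
Hypothesis Nb : N b.

(* The nonnegative part of the radical convex ideal generated by [b]. *)
Definition radical_hull (y : A) :=
  N y /\ exists n c, N c /\ N (c ** b - pow y n).

Local Notation J := radical_hull.

Lemma radical_hull_self : J b.
Proof. by split=> //; exists 1%N, b; split=> //=; rewrite subrr. Qed.

Lemma radical_hull_le x y : N x -> N (y - x) -> J y -> J x.
Proof.
move=> Nx xy [_ [n [c [Nc le_c]]]]; split=> //; exists n, c; split=> //.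
exact: rng_cone_trans (rng_cone_le_pow n Nx xy) le_c.
Qed.

Lemma radical_hull_double y : J y -> J (y + y).
Proof.
move=> [Ny [n [c [Nc le_c]]]]; split; first exact: ND.
have [k eq_k] := rng_pow_double y n; exists n, (c *+ k); split.
  exact: rng_coneMn.
by rewrite eq_k mC rng_mulrnAr mC -mulrnBl; apply: rng_coneMn.
Qed.

(** If $x \le y$ then $x + y \le 2y$, and the factor $2^{n+1}$ arising from the power of $2y$ is
    absorbed into the coefficient [c]. *)
Lemma radical_hullD x y : J x -> J y -> J (x + y).
Proof.
wlog xy : x y / N (y - x) => [wl|] Jx Jy.
  case: (NT (y - x)) => [/wl|]; first exact.
  by rewrite opprB addrC => yx; rewrite addrC; apply: wl => //; rewrite addrC.
apply: (@radical_hull_le _ (y + y)); last exact: radical_hull_double.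
  by apply: ND; [case: Jx | case: Jy].
by rewrite opprD addrACA subrr addr0.
Qed.

Lemma radical_hullM a y : N a -> J y -> J (a ** y).
Proof.
move=> Na [Ny [n [c [Nc le_c]]]]; split; first exact: NM.
exists n, (pow a n ** c); split; first exact: NM (rng_cone_pow n Na) Nc.
rewrite rng_powM -mA -rng_mulrN -mDr.
exact: NM (rng_cone_pow n Na) le_c.
Qed.

Lemma radical_hull_sqr x : N x -> J (x ** x) -> J x.
Proof.
move=> Nx [_ [n [c [Nc le_c]]]]; split=> //; exists (n + n).+1, c.
by split=> //; rewrite -rng_powD -rng_powM.
Qed.

(** The set $N - J$: the elements that are nonnegative along [N] up to an element of the ideal. *)
Definition hull_cone : set A := [set x | exists2 y, J y & N (x + y)].

Lemma sub_hull_cone : N `<=` hull_cone.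
Proof.
by move=> x Nx; exists b; [exact: radical_hull_self | exact: ND].
Qed.

Lemma hull_coneN y : J y -> hull_cone (- y).
Proof. by move=> Jy; exists y => //; rewrite addNr. Qed.

(** An element of $N - J$ outside $N$ is the opposite of an element of $J$, so products of mixed
    sign are handled by the ideal property of $J$. Primality comes from radicality. *)
Lemma rng_cone_hull : (exists x, ~ hull_cone x) -> rng_cone mul hull_cone.
Proof.
have oppJ x : ~ N x -> hull_cone x -> J (- x).
  move=> xneg [y Jy xy]; apply: (radical_hull_le _ _ Jy).
    by case: (NT x).
  by rewrite opprK addrC.
have mixed x y : N x -> ~ N y -> hull_cone y -> hull_cone (x ** y).
  move=> Nx yneg /(oppJ _ yneg) Jy; exists (x ** - y).
    exact: radical_hullM.
  by rewrite -mDr subrr rng_mulr0.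
move=> proper; split=> //.
- move=> x x' [y Jy xy] [y' Jy' xy']; exists (y + y').
    exact: radical_hullD.
  by rewrite addrACA; apply: ND.
- move=> x y Hx Hy.
  have [Nx|xneg] := pselect (N x); have [Ny|yneg] := pselect (N y).
  + exact/sub_hull_cone/NM.
  + exact: mixed.
  + by rewrite mC; apply: mixed.
  + apply: sub_hull_cone; rewrite -(opprK x) rng_mulNr -rng_mulrN.
    by apply: NM; [case: (NT x) | case: (NT y)].
- by move=> x; case: (NT x) => /sub_hull_cone; [left|right].
- move=> x y Hx Hy.
  have [Nx|xneg] := pselect (N x); last first.
    by move=> _; left; apply: sub_hull_cone; case: (NT x).
  have [Ny|yneg] := pselect (N y); last first.
    by move=> _; right; apply: sub_hull_cone; case: (NT y).
  move=> [z Jz xyz].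
  have {xyz} Jxy : J (x ** y).
    by apply: radical_hull_le Jz; [exact: NM | rewrite addrC].
  (* If $0 \le s \le t$ and $st \in J$, then $s^2 \le st$ puts $s^2$, hence $s$, in $J$. It is
     applied to the smaller of the two factors. *)
  have key s t : N s -> N t -> J (s ** t) -> N (t - s) -> hull_cone (- s).
    move=> Ns Nt Jst st; apply/hull_coneN/radical_hull_sqr => //.
    apply: (radical_hull_le _ _ Jst); first exact: NM.
    by rewrite -rng_mulrN -mDr; apply: NM.
  case: (NT (y - x)) => [xy|]; first by left; apply: (key x y).
  by rewrite opprB => xy; right; apply: (key y x) => //; rewrite mC.
Qed.

End Hull.
End OneCone.

(* The new cone adjoins to [N] the radical convex ideal generated by [b1]. If
   that ideal contained [b2], there would be [c] and [k] with [s <= c b2^k s]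
   along [N] for all [s] positive along [M], where the right side vanishes. *)
Lemma rng_cone_between (N M : set A) (b1 b2 : A) :
  rng_cone mul N -> rng_cone mul M -> N `<=` M ->
  N b1 -> M (- b1) -> ~ N (- b2) -> M (- b2) ->
  (forall n, N (pow b2 n - b1)) ->
  exists N', [/\ rng_cone mul N', N `<=` N', N' `<=` M, N' (- b1)
               & ~ N' (- b2)].
Proof.
move=> coneN coneM NM Nb1 Mb1 b2_gt0 Mb2 b1_small.
have Nb2 := rng_cone_pos coneN b2_gt0.
have suppM a x : N a -> M x -> M (- x) -> M (- (a ** x)).
  move=> Na Mx; rewrite -rng_mulrN.
  by apply: (rng_coneM coneM) => //; apply: NM.
have J_supp y : radical_hull N b1 y -> M (- y).
  move=> [Ny [n [c [Nc le_c]]]].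
  have [//|Myn] := pselect (M (- y)).
  case: (rng_cone_pow_gt0 coneM (n := n) Myn).
  have -> : - pow y n = (c ** b1 - pow y n) - c ** b1.
    by rewrite addrAC subrr add0r.
  apply: (rng_coneD coneM); first exact: NM.
  by apply: suppM => //; apply: NM.
have sub_M : hull_cone N b1 `<=` M.
  move=> x [y Jy xy]; rewrite -(addrK y x).
  by apply: (rng_coneD coneM); [exact: NM | exact: J_supp].
have [s sM] := rng_cone_proper coneM; exists (hull_cone N b1); split=> //.
- by apply: rng_cone_hull => //; exists s => /sub_M.
- exact: sub_hull_cone.
- exact/hull_coneN/radical_hull_self.
move=> [y Jy b2y].
have {y Jy b2y} [_ [n [c [Nc le_c]]]] : radical_hull N b1 b2.
  by apply: (radical_hull_le coneN Nb2 _ Jy); rewrite addrC.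
pose u := pow b2 n.
have Nu : N u by apply: rng_cone_pow.
have u_gt0 : ~ N (- u) by apply: rng_cone_pow_gt0.
have Mu : M (- u).
  rewrite /u; case: (n) => //= k; rewrite mC; apply: suppM => //.
    exact: rng_cone_pow.
  exact: NM.
(* The element [- x], positive along [M], plays the part of a unit. *)
have [x Mx] := rng_cone_proper coneM; apply: (Mx).
have Ns : N (- x) by case: (rng_cone_total coneN x) => // /NM.
have : N (u ** (c ** - x ** u + x)).
  have -> : u ** (c ** - x ** u + x) = (c ** (u ** u) - u) ** - x.
    rewrite mDr mDl (rng_mulNr u) (rng_mulrN u) opprK; congr (_ + _).
    by rewrite mC -!mA; congr mul; rewrite mC -!mA.
  apply: (rng_coneM coneN) => //.
  apply: (rng_cone_trans coneN le_c).
  rewrite -rng_mulrN -mDr; apply: (rng_coneM coneN) => //.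
  by rewrite rng_powD; apply: b1_small.
move=> /(rng_cone_cancel coneN u_gt0) /NM x_le.
rewrite -(addKr (c ** - x ** u) x) addrC.
apply: (rng_coneD coneM) => //; apply: suppM => //; last exact: NM.
exact: (rng_coneM coneN).
Qed.

End RngCones.

(** * Lattices of sets *)

Record set_ring (T : Type) := SetRing {
  set_ring_mem :> set T -> Prop;
  set_ringU : forall Y Z, set_ring_mem Y -> set_ring_mem Z ->
    set_ring_mem (Y `|` Z);
  set_ringI : forall Y Z, set_ring_mem Y -> set_ring_mem Z ->
    set_ring_mem (Y `&` Z);
}.

Record set_lattice T (K : set_ring T) := SetLattice {
  set_lattice_val : set T;
  set_latticeP : K set_lattice_val;
}.

Section SetLattice.
Variables (T : Type) (K : set_ring T).
Local Notation L := (set_lattice K).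
Local Notation val := (@set_lattice_val T K).

Lemma set_lattice_inj : injective val.
Proof.
by move=> [x Kx] [y Ky] /= eq_xy; case: _ / eq_xy Ky => Ky; congr SetLattice.
Qed.

HB.instance Definition _ := gen_eqMixin L.
HB.instance Definition _ := gen_choiceMixin L.

Definition set_lattice_meet (x y : L) : L :=
  SetLattice (set_ringI (set_latticeP x) (set_latticeP y)).
Definition set_lattice_join (x y : L) : L :=
  SetLattice (set_ringU (set_latticeP x) (set_latticeP y)).
(** Inclusion, expressed through the meet so as to be a boolean relation. *)
Definition set_lattice_le : rel L := fun x y => set_lattice_meet x y == x.
Definition set_lattice_lt : rel L :=
  fun x y => (y != x) && set_lattice_le x y.

Let leE x y : set_lattice_le x y = (set_lattice_meet x y == x).
Proof. by []. Qed.
Let ltE x y : set_lattice_lt x y = (y != x) && set_lattice_le x y.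
Proof. by []. Qed.
Let meetC : commutative set_lattice_meet.
Proof. by move=> x y; apply/set_lattice_inj/setIC. Qed.
Let joinC : commutative set_lattice_join.
Proof. by move=> x y; apply/set_lattice_inj/setUC. Qed.
Let meetA : associative set_lattice_meet.
Proof. by move=> x y z; apply/set_lattice_inj/setIA. Qed.
Let joinA : associative set_lattice_join.
Proof. by move=> x y z; apply/set_lattice_inj/setUA. Qed.
Let joinKI y x : set_lattice_meet x (set_lattice_join x y) = x.
Proof. by apply: set_lattice_inj; apply: setIidl; left. Qed.
Let meetKU y x : set_lattice_join x (set_lattice_meet x y) = x.
Proof. by apply: set_lattice_inj; apply: setUidl => ? []. Qed.
Let meetUl : left_distributive set_lattice_meet set_lattice_join.
Proof. by move=> x y z; apply/set_lattice_inj/setIUl. Qed.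
Let meetxx : idempotent_op set_lattice_meet.
Proof. by move=> x; apply/set_lattice_inj/setIid. Qed.

HB.instance Definition _ := Order.isMeetJoinDistrLattice.Build
  Order.default_display L leE ltE meetC joinC meetA joinA joinKI meetKU meetUl
  meetxx.

Lemma set_lattice_leP (x y : L) : (x <= y)%O <-> val x `<=` val y.
Proof.
rewrite /Order.le /= leE; split=> [/eqP <- s []//|sub_xy].
by apply/eqP/set_lattice_inj/setIidl.
Qed.

End SetLattice.

Lemma set_lattice_isomorphic T (K : set_ring T) :
  isomorphic_to_family (set_lattice K) (set_ring_mem K).
Proof.
exists (@set_lattice_val T K); split; first exact: set_lattice_leP.
by apply/seteqP; split=> [_ [x _ <-]|Z KZ];
  [exact: set_latticeP | exists (SetLattice KZ)].
Qed.

(** * Restricting a lattice of sets to a family of points *)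

Section Trace.
Variables (S T : Type) (f : S -> T) (K : set_ring T).

Definition trace_set : set (set S) := [set f @^-1` Z | Z in set_ring_mem K].

Lemma trace_setU Y Z : trace_set Y -> trace_set Z -> trace_set (Y `|` Z).
Proof.
by move=> [Y' KY <-] [Z' KZ <-]; exists (Y' `|` Z') => //; apply: set_ringU.
Qed.

Lemma trace_setI Y Z : trace_set Y -> trace_set Z -> trace_set (Y `&` Z).
Proof.
by move=> [Y' KY <-] [Z' KZ <-]; exists (Y' `&` Z') => //; apply: set_ringI.
Qed.

Definition trace_ring : set_ring S := SetRing trace_setU trace_setI.

(** Taking traces on points preserves unions and intersections, and so yields a homomorphic image in
    which sets with the same trace are identified. *)
Definition trace (x : set_lattice K) : set_lattice trace_ring :=
  @SetLattice _ trace_ring (f @^-1` set_lattice_val x)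
    (imageP _ (set_latticeP x)).

Lemma trace_mono : {homo trace : x y / (x <= y)%O}.
Proof.
by move=> x y /set_lattice_leP xy; apply/set_lattice_leP => s; apply: xy.
Qed.
HB.instance Definition _ :=
  Order.isOrderMorphism.Build _ _ _ _ trace trace_mono.

Let trace_meet : Order.meet_morphism trace.
Proof. by move=> x y; apply: set_lattice_inj. Qed.
Let trace_join : Order.join_morphism trace.
Proof. by move=> x y; apply: set_lattice_inj. Qed.
HB.instance Definition _ :=
  Order.isLatticeMorphism.Build _ _ _ _ trace trace_meet trace_join.

Lemma trace_surj : range trace = [set: set_lattice trace_ring].
Proof.
apply/seteqP; split=> // -[Z [Y KY eqZ]] _.
by exists (SetLattice KY) => //; apply: set_lattice_inj.
Qed.

End Trace.

(** * The obstruction *)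

(* A chain of three points, together with two points of each of its copies
   indexed by [W]: the middle points of the copies are left out. *)
Inductive chain_point (W : Type) :=
  Base0 | Base1 | Base2 | Copy0 of W | Copy2 of W.
Arguments Base0 {W}.
Arguments Base1 {W}.
Arguments Base2 {W}.

(** The [gen] fields make [Base0], [Base1], [Base2], and likewise [Copy0 w], [Copy2 w], chains of
    specializations; the [ae] fields say that the base is the limit of the copies up to countably
    many indices; [punctured_copy] isolates what lies above one index. *)
Record punctured_chains W (K : set (chain_point W) -> Prop) : Prop := {
  punctured0 : K set0;
  punctured1 : K setT;
  punctured_gen01 : forall Z, K Z -> Z Base1 -> Z Base0;
  punctured_gen12 : forall Z, K Z -> Z Base2 -> Z Base1;
  punctured_genw : forall Z w, K Z -> Z (Copy2 w) -> Z (Copy0 w);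
  punctured_ae0 : forall Z, K Z ->
    countable [set w | ~ (Z (Copy0 w) <-> Z Base0)];
  punctured_ae2 : forall Z, K Z ->
    countable [set w | ~ (Z (Copy2 w) <-> Z Base2)];
  punctured_sep01 : exists Z, [/\ K Z, Z Base0 & ~ Z Base1];
  punctured_sep12 : exists Z, [/\ K Z, Z Base1 & ~ Z Base2];
  punctured_copy : forall w, exists Z,
    K Z /\ forall s, Z s <-> (s = Copy0 w \/ s = Copy2 w);
}.

(** A frame common to real spectra and f-rings: [X] is the set of admissible cones of [A], and
    [sat N x] says that the cone [N] lies in the open set attached to [x]. The hypotheses provide a
    cone for each point, and a lattice element for the positivity locus of each ring element. *)
Lemma punctured_chains_no_cones W (K : set_ring (chain_point W))
    (A : zmodType) (mul : A -> A -> A) (X : set (set A))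
    (sat : set A -> set_lattice K -> Prop) :
  punctured_chains K -> ~ countable [set: W] -> com_rng mul ->
  X `<=` rng_cone mul ->
  (forall M N N', X M -> X N -> rng_cone mul N' -> M `<=` N' -> N' `<=` N ->
     X N') ->
  (forall s : chain_point W, exists2 N, X N &
     forall x, sat N x <-> set_lattice_val x s) ->
  (forall a, exists x, forall N, X N -> (sat N x <-> ~ N (- a))) ->
  (forall N x y, X N -> (x <= y)%O -> sat N x -> sat N y) ->
  (forall N x y, X N -> sat N x -> sat N y -> sat N (x `&` y)%O) ->
  (forall M N x, X M -> X N -> M `<=` N -> sat N x -> sat M x) ->
  False.
Proof.
move=> chK uncW rngA Xcone Xconv pts pos sat_le sat_meet sat_gen.
have /choice[N NP] : forall s, exists N, X N /\
    forall x, sat N x <-> set_lattice_val x s.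
  by move=> s; have [N XN NP] := pts s; exists N.
have /choice[mu muP] := pos.
have XN s : X (N s) by have [] := NP s.
have coneN s : rng_cone mul (N s) by apply/Xcone/XN.
have muN a s : set_lattice_val (mu a) s <-> ~ N s (- a).
  by rewrite -(muP _ _ (XN s)); symmetry; apply: (NP s).2.
(* Specialization of points becomes inclusion of cones, through the positivity loci [mu a]. *)
have N_sub s t : (forall Z, K Z -> Z t -> Z s) -> N s `<=` N t.
  move=> st a Nsa; apply: contrapT; rewrite -[a]opprK => /muN.
  by move=> /(st _ (set_latticeP _))/muN; rewrite opprK.
have N01 : N Base0 `<=` N Base1 by exact: (N_sub _ _ (punctured_gen01 chK)).
have N12 : N Base1 `<=` N Base2 by exact: (N_sub _ _ (punctured_gen12 chK)).
have Nw w : N (Copy0 w) `<=` N (Copy2 w).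
  by apply: N_sub => Z; apply: (punctured_genw chK).
(* If no element were positive at [s] and zero at [t], the two cones would be equal, although [Z]
   separates the points. *)
have sep s t Z : K Z -> Z s -> ~ Z t -> N s `<=` N t ->
    exists b, ~ N s (- b) /\ N t (- b).
  move=> KZ Zs Zt st; apply: contrapT => no_b.
  apply: Zt; have /(_ (SetLattice KZ))[_ /= satZ] := (NP s).2.
  apply/((NP t).2 (SetLattice KZ)).
  suff -> : N t = N s by exact: satZ.
  apply/seteqP; split=> // a Nta; apply: contrapT => Nsa; apply: no_b.
  by exists (- a); rewrite opprK.
have [b1 [b1_gt0 b1_0]] : exists b, ~ N Base0 (- b) /\ N Base1 (- b).
  by have [Z [KZ Z0 Z1]] := punctured_sep01 chK; apply: (sep _ _ Z).
have [b2 [b2_gt0 b2_0]] : exists b, ~ N Base1 (- b) /\ N Base2 (- b).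
  by have [Z [KZ Z0 Z1]] := punctured_sep12 chK; apply: (sep _ _ Z).
(* The difference $b_2^{n+1} - b_1$ is positive at [Base0], since at its specialization [Base1] it
   equals $b_2^{n+1} > 0$. *)
pose d n := iter n (mul b2) b2 - b1.
have d_gt0 n : ~ N Base0 (- d n).
  move=> /N01; rewrite /d opprB => b1_ge.
  apply: (rng_cone_pow_gt0 (coneN Base1) b2_gt0 (n := n)).
  rewrite -(addKr b1 (- _)); exact: (rng_coneD (coneN Base1)).
(* The sequence is $b_1, b_2, d_0, d_1, \dots$. Each term behaves above [w] as at the base, except
   for countably many [w]; hence some [w] is good for all terms at both points. *)
pose fam n := if n is m.+1 then if m is k.+1 then d k else b2 else b1.
pose bad (i : bool * nat) : set W := let Z := set_lattice_val (mu (fam i.2)) in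
  if i.1 then [set w | ~ (Z (Copy0 w) <-> Z Base0)]
  else [set w | ~ (Z (Copy2 w) <-> Z Base2)].
have cbad : countable (\bigcup_i bad i).
  apply: bigcup_countable => [|[[] n] _]; first exact: countableP.
    exact: (punctured_ae0 chK (set_latticeP _)).
  exact: (punctured_ae2 chK (set_latticeP _)).
have [w good] : exists w, ~ (\bigcup_i bad i) w.
  apply: contrapT => all_bad; apply: uncW; apply: sub_countable cbad.
  apply: subset_card_le => w _; apply: contrapT => nw; apply: all_bad.
  by exists w.
have good0 n : ~ N (Copy0 w) (- fam n) <-> ~ N Base0 (- fam n).
  apply: contrapT => ngood; apply: good.
  by exists (true, n); rewrite /bad /= ?muN.
have good2 n : ~ N (Copy2 w) (- fam n) <-> ~ N Base2 (- fam n).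
  apply: contrapT => ngood; apply: good.
  by exists (false, n); rewrite /bad /= ?muN.
have b1w_gt0 : ~ N (Copy0 w) (- b1) by apply/(good0 0%N).
have b1w_0 : N (Copy2 w) (- b1).
  by apply: contrapT => /(good2 0%N); apply; apply: N12.
have b2w_gt0 : ~ N (Copy0 w) (- b2).
  by apply/(good0 1%N) => /N01.
have b2w_0 : N (Copy2 w) (- b2) by apply: contrapT => /(good2 1%N).
have dw n : N (Copy0 w) (d n).
  by apply: (rng_cone_pos (coneN _)); apply/(good0 n.+2); apply: d_gt0.
have Nb1 := rng_cone_pos (coneN _) b1w_gt0.
have [N' [coneN' NN' N'N b1N' b2N']] :=
  rng_cone_between rngA (coneN _) (coneN _) (@Nw w) Nb1 b1w_0 b2w_gt0 b2w_0 dw.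
have XN' : X N' by apply: (Xconv (N (Copy0 w)) (N (Copy2 w))).
(* Among the points above [w], both [b1] and [b2] are positive at [Copy0 w] only. So the meet of [Z]
   with [mu b2] lies below [mu b1], which forces [b1] to be positive along [N'], a contradiction. *)
have [Z [KZ Zw]] := punctured_copy chK w.
have satZ : sat N' (SetLattice KZ).
  apply: (sat_gen _ (N (Copy2 w))) => //; apply/(NP _).2 => /=.
  by apply/Zw; right.
have satb2 : sat N' (mu b2) by apply/muP.
have : sat N' (mu b1).
  apply: (sat_le _ (SetLattice KZ `&` mu b2)%O) => //; last exact: sat_meet.
  apply/set_lattice_leP => s [/Zw[] -> /muN] // _; exact/muN.
by rewrite muP.
Qed.

(** * Compact open sets of the real spectrum *)

Section RealSpectrum.
Variable R : comPzRingType.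
Local Notation Sper := (real_spectrum R).

Lemma prime_cone_suppP (P : set R) a :
  (P `&` [set - x | x in P]) a <-> P a /\ P (- a).
Proof.
split=> [[Pa [x Px xa]]|[Pa PNa]]; first by rewrite -{2}xa opprK.
by split=> //; exists (- a); rewrite ?opprK.
Qed.

Lemma prime_cone_or (P : set R) a : prime_cone P -> P a \/ P (- a).
Proof.
move=> coneP; have [|[x Px <-]] : (P `|` [set - x | x in P]) a.
  by rewrite -(prime_cone_total coneP).
  by left.
by right; rewrite opprK.
Qed.

Lemma prime_cone_suppM (P : set R) a x : prime_cone P -> P x -> P (- x) ->
  P (a * x) /\ P (- (a * x)).
Proof.
move=> coneP Px PNx; apply/prime_cone_suppP.
by apply: (prime_idealM (prime_cone_support coneP)); apply/prime_cone_suppP.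
Qed.

Lemma prime_coneN1 (P : set R) : prime_cone P -> ~ P (-1).
Proof.
move=> coneP PN1; apply: (prime_ideal_proper (prime_cone_support coneP)).
by apply/prime_cone_suppP; split=> //; apply: cone1 (prime_cone_cone coneP).
Qed.

Lemma prime_cone_supp_prime (P : set R) x y : prime_cone P ->
  P (x * y) -> P (- (x * y)) -> (P x /\ P (- x)) \/ (P y /\ P (- y)).
Proof.
move=> coneP Pxy PNxy; rewrite -!prime_cone_suppP.
apply: (prime_ideal_prime (prime_cone_support coneP)).
exact/prime_cone_suppP.
Qed.

(* The axioms of prime cones amount to inclusions of finite intersections in
   finite unions of the sets [{P | a \notin P}]. *)
Lemma prime_cone_of_assignment (phi : R -> Prop) :
  (forall s t : seq R,
     (forall P : Sper, (forall a, a \in s -> ~ sval P a) ->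
        exists2 b, b \in t & ~ sval P b) ->
     (forall a, a \in s -> phi a) -> exists2 b, b \in t & phi b) ->
  prime_cone [set a | ~ phi a].
Proof.
move=> phiP.
have incl1 a (t : seq R) : (forall P : set R, prime_cone P -> ~ P a ->
    exists2 b, b \in t & ~ P b) -> phi a -> exists2 b, b \in t & phi b.
  move=> aP phia; apply: (phiP [:: a]) => [[P coneP] /= Pa|b].
    by apply: aP => //; apply: Pa; rewrite mem_head.
  by rewrite inE => /eqP ->.
have incl2 a b (t : seq R) :
    (forall P : set R, prime_cone P -> ~ P a -> ~ P b ->
       exists2 c, c \in t & ~ P c) -> phi a -> phi b ->
    exists2 c, c \in t & phi c.
  move=> aP phia phib; apply: (phiP [:: a; b]) => [[P coneP] /= Pab|c].
    by apply: aP => //; apply: Pab; rewrite !inE eqxx ?orbT.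
  by rewrite !inE => /orP[] /eqP ->.
have mem0 a : (forall P : set R, prime_cone P -> P a) -> ~ phi a.
  by move=> aP /(@incl1 _ [::])[] // P coneP; case; apply: aP.
have le2 a b c : (forall P : set R, prime_cone P -> P b -> P c -> P a) ->
    phi a -> phi b \/ phi c.
  move=> abc /(@incl1 _ [:: b; c])[P coneP Pa|d].
    have [Pb|] := pselect (P b); last by exists b; rewrite ?mem_head.
    exists c; first by rewrite !inE eqxx orbT.
    by move=> Pc; apply: Pa; apply: abc.
  by rewrite !inE => /orP[] /eqP -> ?; [left|right].
have notboth a : phi a -> phi (- a) -> False.
  move=> phia phiNa; have [|c] // := @incl2 a (- a) [::] _ phia phiNa.
  by move=> P coneP Pa PNa; case: (prime_cone_or a coneP).
have suppE a : ([set b | ~ phi b] `&` [set - x | x in [set b | ~ phi b]]) a <->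
    ~ phi a /\ ~ phi (- a) by exact: prime_cone_suppP.
split.
- split.
  + by apply: mem0 => P /prime_cone_cone/cone0.
  + move=> x y /= phix phiy /(@le2 _ x y)[|//|//].
    by move=> P /prime_cone_cone/coneD; apply.
  + by apply: mem0 => P /prime_cone_cone/cone1.
  + move=> x y /= phix phiy /(@le2 _ x y)[|//|//].
    by move=> P /prime_cone_cone/coneM; apply.
  + by move=> x; apply: mem0 => P /prime_cone_cone/cone_sqr.
- apply/seteqP; split=> // x _.
  have [phix|] := pselect (phi x); last by left.
  by right; exists (- x); rewrite ?opprK // => /(notboth _ phix).
- split.
  + by apply/suppE; rewrite oppr0; split;
      apply: mem0 => P /prime_cone_cone/cone0.
  + move=> x y /suppE[x1 x2] /suppE[y1 y2]; apply/suppE; split.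
      by move=> /(@le2 _ x y)[|//|//] P /prime_cone_cone/coneD; apply.
    rewrite opprD => /(@le2 _ (- x) (- y))[|//|//].
    by move=> P /prime_cone_cone/coneD; apply.
  + move=> a x /suppE[x1 x2]; apply/suppE; split.
      move=> /(@le2 _ x (- x))[|//|//] P coneP Px PNx.
      by case: (prime_cone_suppM a coneP Px PNx).
    move=> /(@le2 _ x (- x))[|//|//] P coneP Px PNx.
    by case: (prime_cone_suppM a coneP Px PNx).
  + move=> /suppE[_]; apply.
    have [//||c] := phiP [::] [:: -1].
      by move=> [P coneP] _; exists (-1);
        [exact: mem_head | exact: prime_coneN1].
      by [].
    by rewrite inE => /eqP ->.
  + move=> x y /suppE[xy1 xy2].
    apply: contrapT => /not_orP[/suppE/not_andP nx /suppE/not_andP ny].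
    have split2 a : ~ ~ phi a \/ ~ ~ phi (- a) ->
        exists2 b, phi b & b = a \/ b = - a.
      by move=> [/contrapT|/contrapT] ?; [exists a|exists (- a)]; auto.
    have [x' phix x'E] := split2 _ nx; have [y' phiy y'E] := split2 _ ny.
    have [P coneP Px Py|c] := @incl2 x' y' [:: x * y; - (x * y)] _ phix phiy.
      have [Pxy|] := pselect (P (x * y)); last first.
        by exists (x * y); rewrite ?mem_head.
      have [PNxy|] := pselect (P (- (x * y))); last first.
        by exists (- (x * y)); rewrite ?inE ?eqxx ?orbT.
      have [] := prime_cone_supp_prime coneP Pxy PNxy => -[??].
        by case: x'E Px => ->.
      by case: y'E Py => ->.
    by rewrite !inE => /orP[] /eqP ->.
Qed.

Definition basic_open (s : seq R) : set Sper :=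
  [set P | forall a, a \in s -> ~ sval P a].

Definition finitary_open (ss : seq (seq R)) : set Sper :=
  [set P | exists2 s, s \in ss & basic_open s P].

Lemma open_basic_open s : open (basic_open s).
Proof.
elim: s => [|a s ih].
  rewrite (_ : basic_open [::] = setT); first exact: openT.
  by apply/seteqP; split.
rewrite (_ : basic_open _ = [set P : Sper | ~ sval P a] `&` basic_open s).
  apply: openI => //.
  exists [set [set P : Sper | ~ sval P a]]; last by rewrite bigcup_set1.
  by move=> _ ->; apply: finI_from1; exists a.
apply/seteqP; split=> [P Ps|P [Pa Ps] b].
  split; first by apply: Ps; rewrite mem_head.
  by move=> b bs; apply: Ps; rewrite inE bs orbT.
by rewrite inE => /orP[/eqP ->|/Ps].
Qed.

Lemma finI_from_basic_open (I : choiceType) (D : set I) (b : I -> set Sper) V :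
  (forall i, D i -> exists a, b i = [set P | ~ sval P a]) ->
  finI_from D b V -> exists s, V = basic_open s.
Proof.
move=> bD [E ED <-].
have /choice[f fE] : forall i, exists a, i \in E -> b i = [set P | ~ sval P a].
  move=> i; have [iE|] := boolP (i \in E); last by exists 0.
  by have [|a ->] := bD i; [have := ED i iE; rewrite inE | exists a].
exists [seq f i | i <- enum_fset E]; apply/seteqP; split=> P.
  by move=> EP _ /mapP[i iE ->]; have := EP i iE; rewrite (fE i iE).
by move=> sP i iE; rewrite (fE i iE); apply: sP; apply: map_f.
Qed.

Lemma open_nbhs_basic (U : set Sper) P : open U -> U P ->
  exists2 s, basic_open s P & basic_open s `<=` U.
Proof.
move=> [D Dsub <-] [V DV VP].
have [|s VE] := finI_from_basic_open _ (Dsub _ DV).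
  by move=> _ [a _ <-]; exists a.
exists s; first by rewrite -VE.
by move=> Q; rewrite -VE; exists V.
Qed.

Lemma open_finitary_open ss : open (finitary_open ss).
Proof.
rewrite (_ : finitary_open ss = \bigcup_(s in [set` ss]) basic_open s).
  by apply: bigcup_open => s _; apply: open_basic_open.
by apply/seteqP; split=> P [s]; exists s.
Qed.

Lemma filter_basic_open (F : set_system Sper) (FF : Filter F) s :
  F (basic_open s) <-> forall a, a \in s -> F [set P : Sper | ~ sval P a].
Proof.
split=> [Fs a as_|]; first by apply: filterS Fs => P; apply.
elim: s => [_|a s ih Fas]; first by apply: filterS filterT => P.
have Fa := Fas a (mem_head a s).
have /ih Fs b : b \in s -> F [set P : Sper | ~ sval P b].
  by move=> bs; apply: Fas; rewrite inE bs orbT.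
apply: filterS (filterI Fa Fs) => P [Pa Ps] b.
by rewrite inE => /orP[/eqP ->|/Ps].
Qed.

Lemma ultra_seq (F : set_system Sper) (UF : UltraFilter F) (I : eqType)
    (s : seq I) (U : I -> set Sper) :
  F [set P | exists2 i, i \in s & U i P] -> exists2 i, i \in s & F (U i).
Proof.
move=> Fs; apply: contrapT => none.
have Fnot i : i \in s -> F (~` U i).
  move=> is_; have [Fi|//] := in_ultra_setVsetC (U i) UF.
  by case: none; exists i.
have FN : F [set P | forall i, i \in s -> ~ U i P].
  elim: s {Fs none} Fnot => [_|i s ih Fis]; first by apply: filterS filterT.
  have /ih Fs j : j \in s -> F (~` U j).
    by move=> js; apply: Fis; rewrite inE js orbT.
  apply: filterS (filterI (Fis i (mem_head i s)) Fs) => P [Pi Ps] j.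
  by rewrite inE => /orP[/eqP ->|/Ps].
by have [P [[i is_ Ui] /(_ i is_)]] := filter_ex (filterI Fs FN).
Qed.

(** An ultrafilter [F] converges to the cone of those [a] for which the set where [a] is outside the
    cone is not in [F]. This is a prime cone because [F] respects finite intersections and finite
    unions. *)
Lemma compact_finitary_open ss : compact (finitary_open ss).
Proof.
rewrite compact_ultra => F UF /ultra_seq[s sss /filter_basic_open Fs].
pose phi a := F [set P : Sper | ~ sval P a].
have coneP : prime_cone [set a | ~ phi a].
  apply: prime_cone_of_assignment => t u tu Ft'.
  have Ft : F (basic_open t) by apply/filter_basic_open.
  by apply: ultra_seq; apply: filterS Ft => P; apply: tu.
pose P : Sper := exist _ _ coneP.
exists P; split; first by exists s => // a /Fs phia; apply.
move=> U; rewrite nbhsE => -[V [oV PV] VU].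
have [t Pt tV] := open_nbhs_basic oV PV.
apply: filterS (subset_trans tV VU) _; apply/filter_basic_open => a /Pt.
exact: contrapT.
Qed.

(** If a compact open [U] were not a finite union of basic sets, the complements in [U] of the
    finitary opens inside [U] would generate a proper filter. A cluster point in [U] has a basic
    neighbourhood inside [U], and the filter contains the complement of that neighbourhood. *)
Lemma compact_openP (U : set Sper) :
  compact_opens U <-> exists ss, U = finitary_open ss.
Proof.
split=> [[cU oU]|[ss ->]]; last first.
  by split; [exact: compact_finitary_open | exact: open_finitary_open].
apply: contrapT => no_cover.
pose inU := [set ss : seq (seq R) | finitary_open ss `<=` U].
pose F := filter_from inU (fun ss => U `\` finitary_open ss).
have FF : ProperFilter F.
  apply: filter_from_proper.
    apply: filter_from_filter.
      by exists [::] => P [].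
    move=> ss tt ssU ttU; exists (ss ++ tt) => [P [s]|P [UP nP]].
      rewrite mem_cat => /orP[ss_s|tt_s] Ps; first by apply: ssU; exists s.
      by apply: ttU; exists s.
    by split; split=> // -[s s_in Ps]; apply: nP; exists s;
      rewrite // mem_cat s_in ?orbT.
  move=> ss ssU; apply: contrapT => noP; apply: no_cover; exists ss.
  apply/seteqP; split=> // P UP; apply: contrapT => nP; apply: noP.
  by exists P.
have [|P [UP clP]] := cU F FF; first by exists [::] => // P [].
have [s Ps sU] := open_nbhs_basic oU UP.
have Fs : F (U `\` finitary_open [:: s]).
  by exists [:: s] => // Q [t]; rewrite mem_seq1 => /eqP ->; apply: sU.
have nbhs_s : nbhs P (basic_open s).
  by rewrite nbhsE; exists (basic_open s) => //; split=> //;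
    apply: open_basic_open.
have [Q [[_ nQ] sQ]] := clP _ _ Fs nbhs_s.
by apply: nQ; exists s; rewrite ?mem_head.
Qed.

Lemma compact_opensU (U V : set Sper) :
  compact_opens U -> compact_opens V -> compact_opens (U `|` V).
Proof.
by move=> [cU oU] [cV oV]; split; [exact: compactU | exact: openU].
Qed.

Lemma compact_opensI (U V : set Sper) :
  compact_opens U -> compact_opens V -> compact_opens (U `&` V).
Proof.
move=> /compact_openP[ss ->] /compact_openP[tt ->]; apply/compact_openP.
exists [seq s ++ t | s <- ss, t <- tt]; apply/seteqP; split=> P.
  move=> [[s sss Ps] [t ttt Pt]]; exists (s ++ t); first exact: allpairs_f.
  by move=> a; rewrite mem_cat => /orP[/Ps|/Pt].
move=> [_ /allpairsP[[s t] [sss ttt ->]] /= Pst].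
by split; [exists s | exists t] => // a as_; apply: Pst;
  rewrite mem_cat as_ ?orbT.
Qed.

Definition compact_open_ring : set_ring Sper :=
  @SetRing _ (@compact_opens Sper) compact_opensU compact_opensI.

(** The subbasic condition [~ sval P a] reads $a < 0$ at [P]; the sign turns it into $a > 0$. *)
Definition pos_open (a : R) : set Sper := [set P | ~ sval P (- a)].

Lemma compact_open_pos a : compact_opens (pos_open a).
Proof.
apply/compact_openP; exists [:: [:: - a]]; apply/seteqP; split=> P.
  move=> Pa; exists [:: - a]; rewrite ?mem_head // => b.
  by rewrite inE => /eqP ->.
by move=> [s]; rewrite inE => /eqP ->; apply; rewrite mem_head.
Qed.

Lemma compact_open_gen (U : set Sper) P Q :
  compact_opens U -> sval P `<=` sval Q -> U Q -> U P.
Proof.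
move=> /compact_openP[ss ->] PQ [s sss Qs]; exists s => // a /Qs.
exact: contra_not (@PQ a).
Qed.

End RealSpectrum.

(** * Prime filters of compact open sets come from points *)

Section PrimeFilters.
Variables (R : comPzRingType) (psi : set (real_spectrum R) -> Prop).
Local Notation Sper := (real_spectrum R).
Hypothesis psi_le : forall U V : set Sper, compact_opens U -> compact_opens V ->
  U `<=` V -> psi U -> psi V.
Hypothesis psiI : forall U V : set Sper, compact_opens U -> compact_opens V ->
  psi U -> psi V -> psi (U `&` V).
Hypothesis psiU : forall U V : set Sper, compact_opens U -> compact_opens V ->
  psi (U `|` V) -> psi U \/ psi V.
Hypothesis psi0 : ~ psi set0.
Hypothesis psiT : psi setT.

Let phi a := psi [set P : Sper | ~ sval P a].

Let compact_basic (s : seq R) : compact_opens (basic_open s).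
Proof.
apply/compact_openP; exists [:: s]; apply/seteqP; split=> P.
  by exists s; rewrite ?mem_head.
by move=> [t]; rewrite mem_seq1 => /eqP ->.
Qed.

Let subbasicE a : [set P : Sper | ~ sval P a] = basic_open [:: a].
Proof.
apply/seteqP; split=> P; first by move=> Pa b; rewrite mem_seq1 => /eqP ->.
by apply; rewrite mem_head.
Qed.

Let psi_basic s : psi (basic_open s) <-> forall a, a \in s -> phi a.
Proof.
split=> [psis a as_|].
  apply: (psi_le (compact_basic s)) psis; first by rewrite subbasicE.
  by move=> P; apply.
elim: s => [_|a s ih phis].
  by rewrite (_ : basic_open _ = setT) //; apply/seteqP; split.
have -> : basic_open (a :: s) = basic_open [:: a] `&` basic_open s.
  rewrite -subbasicE; apply/seteqP; split=> [P Ps|P [Pa Ps] b].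
    split=> [|b bs]; apply: Ps; first exact: mem_head.
    by rewrite inE bs orbT.
  by rewrite inE => /orP[/eqP ->|/Ps].
apply: psiI => //; first by rewrite -subbasicE; apply: phis; apply: mem_head.
by apply: ih => b bs; apply: phis; rewrite inE bs orbT.
Qed.

Let psi_finitary ss : psi (finitary_open ss) <->
  exists2 s, s \in ss & psi (basic_open s).
Proof.
have compact_fin tt : compact_opens (@finitary_open R tt).
  by apply/compact_openP; exists tt.
split=> [|[s sss]]; last by apply: psi_le => // P; exists s.
elim: ss => [|s ss ih].
  by rewrite (_ : finitary_open _ = set0) //; apply/seteqP; split=> P [].
have -> : finitary_open (s :: ss) = basic_open s `|` finitary_open ss.
  apply/seteqP; split=> [P [t]|P [Ps|[t tss Pt]]].
  - by rewrite inE => /orP[/eqP ->|tss] Pt; [left|right; exists t].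
  - by exists s; rewrite ?mem_head.
  - by exists t; rewrite // inE tss orbT.
move=> /psiU[//|//|psis|/ih[t tss psit]].
  by exists s; rewrite ?mem_head.
by exists t; rewrite // inE tss orbT.
Qed.

(** The cone is read off the values of [psi] on subbasic sets. As [psi] respects finite meets and
    joins, these values satisfy every inclusion required of a prime cone and determine [psi] on all
    compact opens. *)
Lemma prime_filter_point :
  exists P : Sper, forall U, compact_opens U -> (psi U <-> U P).
Proof.
have coneP : prime_cone [set a | ~ phi a].
  apply: prime_cone_of_assignment => s t st /psi_basic psis.
  have [] // := (psi_finitary [seq [:: b] | b <- t]).1.
    apply: psi_le psis => //; first by apply/compact_openP; eexists.
    move=> P /st[b bt Pb]; exists [:: b]; first exact: map_f.
    by rewrite -subbasicE.
  by move=> _ /mapP[b bt ->]; rewrite -subbasicE; exists b.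
exists (exist _ _ coneP) => U /compact_openP[ss ->].
rewrite psi_finitary; split=> -[s sss Ps]; exists s => //.
  by move=> a as_; apply; move: a as_; apply/psi_basic.
by apply/psi_basic => a /Ps /contrapT.
Qed.

End PrimeFilters.

(** * The obstruction for real spectra *)

Lemma prime_cone_rng_cone (R : comPzRingType) (P : set R) :
  prime_cone P -> rng_cone *%R P.
Proof.
move=> coneP; have [_ PD _ PM _] := prime_cone_cone coneP; split=> //.
- by move=> x; apply: prime_cone_or.
- move=> x y Px Py PNxy.
  by case: (prime_cone_supp_prime coneP (PM _ _ Px Py) PNxy) => -[_ ?]; auto.
- by exists (-1); apply: prime_coneN1.
Qed.

Lemma rng_cone_prime_cone (R : comPzRingType) (P : set R) :
  rng_cone *%R P -> ~ P (-1) -> prime_cone P.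
Proof.
move=> [PD PM PT Pprime _] PN1.
have P0 : P 0 by case: (PT 0) => //; rewrite oppr0.
have suppM a x : P a -> P x -> P (- x) -> P (- (a * x)).
  by move=> Pa Px PNx; rewrite -mulrN; apply: PM.
split.
- split=> //; first by case: (PT 1).
  move=> x; rewrite expr2.
  by case: (PT x) => Px; last rewrite -mulrNN; apply: PM.
- apply/seteqP; split=> // x _; case: (PT x) => Px; first by left.
  by right; exists (- x); rewrite ?opprK.
- split.
  + by apply/prime_cone_suppP; rewrite oppr0.
  + move=> x y /prime_cone_suppP[x1 x2] /prime_cone_suppP[y1 y2].
    by apply/prime_cone_suppP; rewrite opprD; split; apply: PD.
  + move=> a x /prime_cone_suppP[x1 x2]; apply/prime_cone_suppP.
    case: (PT a) => Pa; split.
    * exact: PM.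
    * exact: suppM.
    * by rewrite -mulrNN; apply: PM.
    * by rewrite -mulNr; apply: PM.
  + by move=> /prime_cone_suppP[].
  + have wl x y : P x -> P y -> P (- (x * y)) ->
        (P x /\ P (- x)) \/ (P y /\ P (- y)).
      by move=> Px Py /(Pprime _ _ Px Py)[]; auto.
    move=> x y /prime_cone_suppP[xy1 xy2]; rewrite !prime_cone_suppP.
    case: (PT x) => Px; case: (PT y) => Py.
    * exact: wl.
    * by have := wl x (- y) Px Py; rewrite mulrN !opprK => /(_ xy1); tauto.
    * by have := wl (- x) y Px Py; rewrite mulNr !opprK => /(_ xy1); tauto.
    * by have := wl (- x) (- y) Px Py; rewrite mulrNN !opprK => /(_ xy2); tauto.
Qed.

Lemma punctured_chains_not_real W (K : set_ring (chain_point W)) :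
  punctured_chains K -> ~ countable [set: W] ->
  ~ real_representable (set_lattice K).
Proof.
move=> chK uncW [R [g [g_le g_range]]].
have gK x : compact_opens (g x) by rewrite -g_range; exists x.
have g_onto U : compact_opens U -> exists x, g x = U.
  by rewrite -g_range => -[x _]; exists x.
have g_meet x y : g (x `&` y)%O = g x `&` g y.
  apply/seteqP; split.
    by rewrite subsetI; split; apply/g_le; rewrite (leIl, leIr).
  have [z gz] := g_onto _ (compact_opensI (gK x) (gK y)).
  rewrite -gz; apply/g_le; rewrite lexI; apply/andP.
  by split; apply/g_le; rewrite gz => P [].
have g_join x y : g (x `|` y)%O = g x `|` g y.
  apply/seteqP; split; last first.
    by rewrite subUset; split; apply/g_le; rewrite (leUl, leUr).
  have [z gz] := g_onto _ (compact_opensU (gK x) (gK y)).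
  rewrite -gz; apply/g_le; rewrite leUx; apply/andP.
  by split; apply/g_le; rewrite gz => P; [left | right].
(* The frame speaks of arbitrary subsets of the ring, so the proof of primality is bundled
   existentially; proof irrelevance makes its choice immaterial. *)
pose sat (P : set R) x := exists coneP : prime_cone P, g x (exist _ P coneP).
have satE (P : real_spectrum R) x : sat (sval P) x <-> g x P.
  case: P => P coneP; split=> [[coneP']|]; last by exists coneP.
  by rewrite (Prop_irrelevance coneP' coneP).
apply: (@punctured_chains_no_cones W K R *%R (@prime_cone R) sat chK uncW).
- by split; [exact: mulrA | exact: mulrC | exact: mulrDl].
- by move=> P; apply: prime_cone_rng_cone.
- move=> M N N' _ coneN coneN' _ N'N; apply: rng_cone_prime_cone => // /N'N.
  exact: prime_coneN1.
- move=> s.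
  (* The lattice elements containing [s] form a prime filter of compact opens; the point of the real
     spectrum that it defines is the cone realizing [s]. *)
  pose psi U := exists2 x, g x = U & set_lattice_val x s.
  have psiP x : psi (g x) <-> set_lattice_val x s.
    split=> [[y gyx ys]|]; last by exists x.
    by apply: ((set_lattice_leP y x).1 _ _ ys); apply/g_le; rewrite gyx.
  have [|||||P PP] := @prime_filter_point R psi.
  + move=> U V /g_onto[x <-] /g_onto[y <-] /g_le /set_lattice_leP xy.
    by rewrite !psiP; apply: xy.
  + move=> U V /g_onto[x <-] /g_onto[y <-]; rewrite -g_meet !psiP.
    by split.
  + move=> U V /g_onto[x <-] /g_onto[y <-]; rewrite -g_join !psiP.
    by case; auto.
  + have [y gy] : exists x, g x = set0.
      by apply: g_onto; apply/compact_openP; exists [::];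
        apply/seteqP; split=> P [].
    rewrite -gy psiP => ys.
    have /g_le/set_lattice_leP/(_ s ys) :
        g y `<=` g (SetLattice (punctured0 chK)).
      by rewrite gy.
    by [].
  + have [y gy] : exists x, g x = setT.
      by apply: g_onto; apply/compact_openP; exists [:: [::]];
        apply/seteqP; split=> // P _; exists [::].
    rewrite -gy psiP.
    have /g_le/set_lattice_leP : g (SetLattice (punctured1 chK)) `<=` g y.
      by rewrite gy.
    exact.
  + exists (sval P); first exact: svalP.
    by move=> x; rewrite satE -PP // psiP.
- move=> a; have [x gx] := g_onto _ (compact_open_pos a); exists x.
  by move=> N coneN; rewrite -[N]/(sval (exist _ N coneN)) satE gx.
- by move=> N x y coneN /g_le xy [coneN' Nx]; exists coneN'; apply: xy.
- move=> N x y coneN; rewrite -[N]/(sval (exist _ N coneN)) !satE g_meet.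
  by split.
- move=> M N x coneM coneN MN.
  rewrite -[M]/(sval (exist _ M coneM)) -[N]/(sval (exist _ N coneN)) !satE.
  exact: compact_open_gen.
Qed.

(** * f-rings *)

Section FRings.
Variable A : comFRingType.
Local Notation "x ** y" := (@lmul A x y) (at level 40, left associativity).
Local Notation pow x n := (iter n (lmul x) x).

Lemma fring_com_rng : com_rng (@lmul A).
Proof. by split; [exact: lmulA | exact: lmulC | exact: lmulDl]. Qed.
Let rngA := fring_com_rng.

Lemma fring_subr_ge0 (x y : A) : (0 <= y - x) = (x <= y).
Proof.
apply/idP/idP => [/(lor_leD2r x)|/(lor_leD2r (- x))].
  by rewrite add0r subrK.
by rewrite subrr.
Qed.

Lemma fring_addr_ge0 (x y : A) : 0 <= x -> 0 <= y -> 0 <= x + y.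
Proof. by move=> x0 /(lor_leD2r x); rewrite add0r addrC; apply: le_trans. Qed.

Lemma fring_mulr_ge0 (x y : A) : 0 <= x -> 0 <= y -> 0 <= x ** y.
Proof. by move=> x0 /(lor_leM2l x _ _ x0); rewrite (rng_mulr0 rngA). Qed.

Definition pos_part (x : A) := ljoin x 0.
Local Notation p := pos_part.

Lemma pos_part_ge0 x : 0 <= p x.
Proof. by have := lexx (p x); rewrite {1}ljoin_le => /andP[]. Qed.

Lemma pos_part_ge x : x <= p x.
Proof. by have := lexx (p x); rewrite {1}ljoin_le => /andP[]. Qed.

Lemma pos_part_le x y : x <= y -> 0 <= y -> p x <= y.
Proof. by move=> xy y0; rewrite ljoin_le xy. Qed.

Lemma ge0_pos_partN x : 0 <= x -> p (- x) = 0.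
Proof.
move=> x0; apply/le_anti; rewrite pos_part_ge0 andbT; apply: pos_part_le => //.
by rewrite -fring_subr_ge0 sub0r opprK.

Qed.

Lemma ljoinDr (x y z : A) : ljoin (x + z) (y + z) = ljoin x y + z.
Proof.
have subD u v : (u + z <= v) = (u <= v - z).
  by rewrite -[LHS]fring_subr_ge0 -[RHS]fring_subr_ge0 opprD addrA addrAC.
have := lexx (ljoin x y); rewrite {1}ljoin_le => /andP[xj yj].
apply/le_anti; rewrite ljoin_le !subD addrK xj yj /= ljoin_le -!subD.
by rewrite -ljoin_le lexx.
Qed.

Lemma pos_partB x : p x - p (- x) = x.
Proof.
have -> : p x = p (- x) + x.
  by rewrite -ljoinDr addNr add0r /pos_part; apply/le_anti; rewrite !ljoin_le;
    have := lexx (p x); rewrite {1}ljoin_le => /andP[-> ->];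
    have := lexx (ljoin 0 x); rewrite {1}ljoin_le => /andP[-> ->].
by rewrite addrAC subrr add0r.
Qed.

(** This formula and the next reduce closure under joins and meets to closure under sums,
    differences and positive parts. *)
Lemma ljoin_pos_part (x y : A) : ljoin x y = p (x - y) + y.
Proof. by rewrite /pos_part -ljoinDr subrK add0r. Qed.

Lemma lmeet_pos_part (x y : A) : lmeet x y = x - p (x - y).
Proof.
have subl (u v w : A) : (u <= v - w) = (w <= v - u).
  by rewrite -[LHS]fring_subr_ge0 -[RHS]fring_subr_ge0 addrAC.
apply/le_anti/andP; split.
  rewrite subl ljoin_le subl opprB addrC subrK.
  have := lexx (lmeet x y); rewrite {1}le_lmeet => /andP[mx my].
  by rewrite my fring_subr_ge0.
have subm (u v w : A) : (u - v <= w) = (u - w <= v).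
  by rewrite -[LHS]fring_subr_ge0 -[RHS]fring_subr_ge0 !opprB addrCA.
by rewrite le_lmeet subm subrr pos_part_ge0 subm pos_part_ge.
Qed.

Lemma pos_part_disjoint x : lmeet (p x) (p (- x)) = 0.
Proof.
rewrite lmeet_pos_part pos_partB; exact: subrr.
Qed.

(** Since $x^+ \wedge x^- = 0$, the f-ring axiom allows each side to be multiplied in turn. Both
    sides become $x^+x^-$, which is thus disjoint from itself. *)
Lemma pos_partM0 x : p x ** p (- x) = 0.
Proof.
have [xp xn] := (pos_part_ge0 x, pos_part_ge0 (- x)).
have [dxy _] := fring_disjoint _ _ _ xp xn xp (pos_part_disjoint x).
have dyx : lmeet (p (- x) ** p x) (p x) = 0.
  apply/le_anti; rewrite le_lmeet fring_mulr_ge0 // xp -[X in _ <= X]dxy.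
  have := lexx (lmeet (p (- x) ** p x) (p x)); rewrite {1}le_lmeet.
  by rewrite le_lmeet andbC => ->.
have [d _] := fring_disjoint _ _ _ (fring_mulr_ge0 xn xp) xp xn dyx.
rewrite [X in lmeet _ X]lmulC in d.
rewrite lmulC; apply/le_anti; rewrite fring_mulr_ge0 // andbT -[X in _ <= X]d.
by rewrite le_lmeet lexx.
Qed.

Lemma pos_part_sqr x : p x ** p x = p x ** x.
Proof.
by rewrite -{4}(pos_partB x) lmulDr (rng_mulrN rngA) pos_partM0 subr0.
Qed.

Lemma ge0_pos_part x : 0 <= x -> p x = x.
Proof. by move=> x0; rewrite -{2}(pos_partB x) ge0_pos_partN // subr0. Qed.

Lemma fring_mul_pos_part x y : x ** y =
  (p x ** p y + p (- x) ** p (- y)) - (p x ** p (- y) + p (- x) ** p y).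
Proof.
rewrite -{1}(pos_partB x) -{1}(pos_partB y) lmulDl !lmulDr.
rewrite !(rng_mulNr rngA) !(rng_mulrN rngA) opprK.
by rewrite opprD -!addrA; congr (_ + _); rewrite [RHS]addrCA; congr (_ + _);
  rewrite addrC.
Qed.

Section RadicalIdeal.
Variable J : set A.
Hypothesis radJ : radical_l_ideal J.
Let idJ : l_ideal J := radJ.1.

Lemma l_idealN x : J x -> J (- x).
Proof. by rewrite -sub0r; apply: (l_idealB idJ); apply: (l_ideal0 idJ). Qed.

Lemma l_idealD x y : J x -> J y -> J (x + y).
Proof. by move=> Jx /l_idealN Jy; rewrite -[y]opprK; apply: (l_idealB idJ). Qed.

Lemma l_ideal_pos x : J x -> J (p x).
Proof. by move=> Jx; apply: (l_ideal_join idJ Jx); apply: (l_ideal0 idJ). Qed.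

Lemma l_ideal_le x y : 0 <= x -> x <= y -> J y -> J x.
Proof.
move=> x0 xy Jy; apply: (l_ideal_convex idJ _ Jy x0 xy).
exact: (l_ideal0 idJ).
Qed.

Lemma radical_sqr x : J (x ** x) -> J x.
Proof. exact: (radJ.2 x 1%N). Qed.

(** The square $(x^+b)^2 = (x^+b)(xb)$ is a multiple of $xb$, and $J$ is radical. *)
Lemma l_ideal_posM x b : J (x ** b) -> J (p x ** b).
Proof.
move=> Jxb; apply: radical_sqr.
rewrite (rng_mulACA rngA) pos_part_sqr -(rng_mulACA rngA).
exact: (l_idealMl idJ).
Qed.

(** This is the colon ideal $(J : b)$. It is radical because $x^{n+1}b \in J$ implies $(xb)^{n+1}
    \in J$. *)
Lemma radical_l_ideal_colon b : 0 <= b -> radical_l_ideal [set x | J (x ** b)].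
Proof.
move=> b0.
have clB x y : J (x ** b) -> J (y ** b) -> J ((x - y) ** b).
  move=> Jx Jy; rewrite lmulDl (rng_mulNr rngA).
  exact: (l_idealB idJ).
have clN x : J (x ** b) -> J (- x ** b).
  by rewrite (rng_mulNr rngA); apply: l_idealN.
split; first split=> //=.
- by rewrite (rng_mul0r rngA); apply: (l_ideal0 idJ).
- by move=> a x Jx; rewrite -lmulA; apply: (l_idealMl idJ).
- by move=> a x Jx; rewrite [x ** a]lmulC -lmulA; apply: (l_idealMl idJ).
- move=> x y Jx Jy; rewrite lmeet_pos_part.
  exact: clB Jx (l_ideal_posM (clB _ _ Jx Jy)).
- move=> x y Jx Jy; rewrite ljoin_pos_part.
  have -> : p (x - y) + y = p (x - y) - - y by rewrite opprK.
  exact: clB (l_ideal_posM (clB _ _ Jx Jy)) (clN _ Jy).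
- move=> x y z Jx Jz xy yz.
  by apply: (l_ideal_convex idJ Jx Jz); apply: lor_leM2r.
move=> x n Jxn; apply: (radJ.2 _ n).
rewrite (rng_powM rngA); case: {2}n => [//|m] /=.
by rewrite lmulA; apply: (l_idealMr idJ).
Qed.

End RadicalIdeal.

Definition gen (s : seq A) : set A := smallest (@radical_l_ideal A) [set` s].

Lemma gen_sub s (J : set A) : radical_l_ideal J ->
  (forall a, a \in s -> J a) -> gen s `<=` J.
Proof. by move=> radJ sJ x; apply; split. Qed.

Lemma mem_gen s a : a \in s -> gen s a.
Proof. by move=> as_ J [_]; apply. Qed.

Lemma radical_l_ideal_gen s : radical_l_ideal (gen s).
Proof.
split; first split.
- by move=> J [[/l_ideal0]].
- by move=> x y gx gy J sJ; apply: (l_idealB sJ.1.1); [exact: gx | exact: gy].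
- by move=> a x gx J sJ; apply: (l_idealMl sJ.1.1); exact: gx.
- by move=> a x gx J sJ; apply: (l_idealMr sJ.1.1); exact: gx.
- move=> x y gx gy J sJ.
  by apply: (l_ideal_meet sJ.1.1); [exact: gx | exact: gy].
- move=> x y gx gy J sJ.
  by apply: (l_ideal_join sJ.1.1); [exact: gx | exact: gy].
- move=> x y z gx gz xy yz J sJ.
  by apply: (l_ideal_convex sJ.1.1 _ _ xy yz); [exact: gx | exact: gz].
by move=> x n gx J sJ; apply: (sJ.1.2 x n); exact: gx.
Qed.

(** Two colon ideals are used. From $x \in \langle b\rangle$ it follows that $xa \in J$, hence
    $x^{\pm}a \in J$; then $x \in \langle a\rangle$ gives $x\,x^{\pm} \in J$. So $x^2 \in J$ and $x
    \in J$. *)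
Lemma gen_disjointM a b x : 0 <= a -> 0 <= b ->
  gen [:: a] x -> gen [:: b] x -> gen [:: a ** b] x.
Proof.
move=> a0 b0 ax bx; set J := gen _; have radJ : radical_l_ideal J.
  exact: radical_l_ideal_gen.
have xaJ : J (x ** a).
  apply: (gen_sub (radical_l_ideal_colon radJ a0) _ bx) => c.
  rewrite mem_seq1 /= => /eqP ->; rewrite lmulC.
  exact: mem_gen (mem_head _ _).
have xJ y : 0 <= y -> J (y ** a) -> J (x ** y).
  move=> y0 Jya; apply: (gen_sub (radical_l_ideal_colon radJ y0) _ ax) => c.
  by rewrite mem_seq1 /= => /eqP ->; rewrite lmulC.
apply: (radical_sqr radJ); rewrite -{2}(pos_partB x) lmulDr (rng_mulrN rngA).
apply: (l_idealB radJ.1); apply: xJ; rewrite ?pos_part_ge0 //;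
  apply: (l_ideal_posM radJ) => //.
by rewrite (rng_mulNr rngA); apply: (l_idealN radJ).
Qed.

(** * Supports of cones containing the positive elements of an f-ring *)

Section ConeSupport.
Variable N : set A.
Hypotheses (coneN : rng_cone (@lmul A) N) (N_ge0 : forall a, 0 <= a -> N a).

Let supp : set A := [set a | N a /\ N (- a)].

Lemma rng_cone_le (x y : A) : x <= y -> N x -> N y.
Proof.
rewrite -fring_subr_ge0 => /N_ge0 xy Nx.
by rewrite -(subrK x y); apply: (rng_coneD coneN).
Qed.

Let NN a : supp a -> supp (- a).
Proof. by move=> [Na Nna]; split; rewrite ?opprK. Qed.

Let suppD a b : supp a -> supp b -> supp (a + b).
Proof.
by move=> [Na Nna] [Nb Nnb]; split; rewrite ?opprD; apply: (rng_coneD coneN).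
Qed.

Let suppM a x : supp x -> supp (a ** x).
Proof.
have wl b y : N b -> supp y -> supp (b ** y).
  move=> Nb [Ny Nny]; split; first exact: (rng_coneM coneN).
  by rewrite -(rng_mulrN rngA); apply: (rng_coneM coneN).
case: (rng_cone_total coneN a) => [|Nna xs]; first exact: wl.
by rewrite -[a]opprK (rng_mulNr rngA); apply/NN/wl.
Qed.

Let supp_prime x y : supp (x ** y) -> supp x \/ supp y.
Proof.
have wl a b : N a -> N b -> supp (a ** b) -> supp a \/ supp b.
  by move=> Na Nb [_] /(rng_cone_prime coneN Na Nb)[]; [left|right].
have suppN a : supp (- a) -> supp a by move=> /NN; rewrite opprK.
case: (rng_cone_total coneN x) => Nx; case: (rng_cone_total coneN y) => Ny xy.
- exact: wl.
- by case: (wl x (- y)) => //; [rewrite (rng_mulrN rngA); apply: NN|left|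
    move=> /suppN; right].
- by case: (wl (- x) y) => //; [rewrite (rng_mulNr rngA); apply: NN|
    move=> /suppN; left|right].
- by case: (wl (- x) (- y)) => //;
    [rewrite (rng_mulNr rngA) (rng_mulrN rngA) opprK|
    move=> /suppN; left|move=> /suppN; right].
Qed.

(** Because $(a^+)^2 = a^+a$, the opposite of this square is $a^+(-a) \in N$; the support is
    prime. *)
Lemma rng_cone_pos_part a : N (- a) -> supp (p a).
Proof.
move=> Nna; suff : supp (p a ** p a) by case/supp_prime.
have Npa := N_ge0 (pos_part_ge0 a).
split; first exact: (rng_coneM coneN).
by rewrite pos_part_sqr -(rng_mulrN rngA); apply: (rng_coneM coneN).
Qed.

Lemma radical_l_ideal_supp : radical_l_ideal supp.
Proof.
have supp_p x : supp x -> supp (p x) by move=> [_ /rng_cone_pos_part].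
have suppB x y : supp x -> supp y -> supp (x - y).
  by move=> xs /NN; apply: suppD.
split; first split=> //.
- by split; rewrite ?oppr0; apply: N_ge0.
- by move=> a x xs; rewrite lmulC; apply: suppM.
- by move=> x y xs ys; rewrite lmeet_pos_part; apply/suppB/supp_p/suppB.
- move=> x y xs ys; rewrite ljoin_pos_part; apply/suppD => //.
  exact/supp_p/suppB.
- move=> x y z [Nx _] [_ Nnz] xy yz; split; first exact: rng_cone_le Nx.
  by apply: rng_cone_le Nnz; rewrite -fring_subr_ge0 opprK addrC fring_subr_ge0.
move=> x; elim=> //= n ih /supp_prime[//|]; exact: ih.
Qed.

End ConeSupport.
End FRings.

(** * The obstruction for commutative f-rings *)

Lemma punctured_chains_not_brumfiel W (K : set_ring (chain_point W)) :
  punctured_chains K -> ~ countable [set: W] ->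
  ~ brumfiel_representable (set_lattice K).
Proof.
move=> chK uncW [A [g [g_le g_range]]].
have rngA := fring_com_rng A.
have gK x : exists s, g x = @gen A s.
  have : range g (g x) by exists x.
  by rewrite g_range => -[s ->]; exists s.
have g_onto s : exists x, g x = @gen A s.
  have : @fg_radical_l_ideals A (@gen A s) by exists s.
  by rewrite -g_range => -[x _]; exists x.
have radg x : radical_l_ideal (g x).
  by have [s ->] := gK x; apply: radical_l_ideal_gen.
(* A cone lies in the open set of [x] when the ideal [g x] has an element that is positive along
   it. *)
pose sat (N : set A) x := exists2 a, g x a & ~ N (- a).
pose X : set (set A) :=
  [set N | rng_cone (@lmul A) N /\ forall a, 0 <= a -> N a].
apply: (@punctured_chains_no_cones W K A (@lmul A) X sat chK uncW rngA).
- by move=> N [].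
- by move=> M N N' [coneM M0] _ coneN' MN' _; split=> // a /M0/MN'.
- move=> s.
  (* The elements whose principal radical ideal corresponds to a set containing [s]. This is the
     complement of a prime ideal, namely the support of the cone [N] to be built. *)
  pose T a := exists2 x, g x = @gen A [:: a] & set_lattice_val x s.
  have val_le x y : g x `<=` g y -> set_lattice_val x s -> set_lattice_val y s.
    by move=> /g_le/set_lattice_leP xy; apply: xy.
  have T_gen l x : g x = gen l -> set_lattice_val x s ->
      exists2 a, a \in l & T a.
    elim: l x => [|a l ih] x gx xs.
      suff [] : set_lattice_val (SetLattice (punctured0 chK)) s by [].
      by apply: val_le xs; rewrite gx; apply: gen_sub.
    have [y gy] := g_onto [:: a]; have [z gz] := g_onto l.
    have : set_lattice_val (y `|` z)%O s.
      apply: val_le xs; rewrite gx; apply: gen_sub => // b.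
      rewrite inE => /orP[/eqP ->|bl].
        have /g_le := leUl y z; apply; rewrite gy.
        by apply: mem_gen; rewrite mem_head.
      by have /g_le := leUr z y; apply; rewrite gz; apply: mem_gen.
    move=> [ys|/(ih _ gz)[b bl Tb]]; last by exists b; rewrite // inE bl orbT.
    by exists a; [exact: mem_head | exists y].
  have T_in a l : gen l a -> T a -> exists2 b, b \in l & T b.
    move=> la [x gx xs]; have [y gy] := g_onto l; apply: (T_gen _ y gy).
    apply: val_le xs; rewrite gx gy.
    apply: gen_sub; first exact: radical_l_ideal_gen.
    by move=> b; rewrite mem_seq1 => /eqP ->.
  have T0 : ~ T 0.
    by move=> /(T_in _ [::])[|//]; apply: (l_ideal0 (radical_l_ideal_gen _).1).
  have T_pos a : T a -> T (pos_part a) \/ T (pos_part (- a)).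
    move=> /(T_in _ [:: pos_part a; pos_part (- a)])[|b].
      rewrite -{3}(pos_partB a).
      by apply: (l_idealB (radical_l_ideal_gen _).1); apply: mem_gen;
        rewrite !inE eqxx ?orbT.
    by rewrite !inE => /orP[] /eqP ->; auto.
  have TM a b : 0 <= a -> 0 <= b -> T a -> T b -> T (lmul a b).
    move=> a0 b0 [x gx xs] [y gy ys]; have [z gz] := g_onto [:: lmul a b].
    exists z => //; apply: (val_le (x `&` y)%O); last by split.
    rewrite gz => c cxy; apply: gen_disjointM => //.
      by rewrite -gx; have /g_le := leIl x y; apply.
    by rewrite -gy; have /g_le := leIr y x; apply.
  (* An element is nonnegative when its negative part lies in the prime ideal. *)
  pose N : set A := [set a | ~ T (pos_part (- a))].
  (* A criterion for $a^+$ to lie in the prime ideal: every radical ideal containing some fixed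
     elements outside [T] has a member above $a$. *)
  have pN a b (l : seq A) : (forall J, radical_l_ideal J ->
      (forall c, c \in l -> J c) -> exists2 c, J c & a <= c) ->
      b = pos_part a -> (forall c, c \in l -> ~ T c) -> ~ T b.
    move=> aP -> lT /(T_in _ l)[J [radJ lJ]|c cl /(lT c cl)//].
    have [c Jc ac] := aP J radJ lJ.
    apply: (l_ideal_le radJ (pos_part_ge0 a) _ (l_ideal_pos radJ Jc)).
    by apply: pos_part_le (pos_part_ge0 c); apply: le_trans ac (pos_part_ge c).
  have in2 a b (J : set A) : (forall c, c \in [:: a; b] -> J c) -> J a /\ J b.
    by move=> abJ; split; apply: abJ; rewrite !inE eqxx ?orbT.
  have T2 a b : ~ T a -> ~ T b -> forall c, c \in [:: a; b] -> ~ T c.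
    by move=> Ta Tb c; rewrite !inE => /orP[] /eqP ->.
  have leD (a b c d : A) : a <= b -> c <= d -> a + c <= b + d.
    move=> ab cd; apply: (le_trans (lor_leD2r c _ _ ab)).
    by rewrite addrC [b + d]addrC; apply: lor_leD2r.
  have p0 (a : A) := pos_part_ge0 a.
  have coneN : rng_cone (@lmul A) N.
    split.
    - move=> a b Na Nb; apply: (pN _ _ _ _ erefl (T2 _ _ Na Nb)).
      move=> J radJ abJ; have [Ja Jb] := in2 _ _ _ abJ.
      eexists; first exact: (l_idealD radJ Ja Jb).
      by rewrite opprD; apply: leD; apply: pos_part_ge.
    - move=> a b Na Nb; apply: (pN _ _ _ _ erefl (T2 _ _ Na Nb)).
      move=> J radJ abJ; have [Ja Jb] := in2 _ _ _ abJ.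
      (* The bound is $-ab \le a^+b^- + a^-b^+$. *)
      exists (lmul (pos_part a) (pos_part (- b)) +
          lmul (pos_part (- a)) (pos_part b)).
        by apply: (l_idealD radJ);
          [exact: (l_idealMl radJ.1) | exact: (l_idealMr radJ.1)].
      rewrite -fring_subr_ge0 opprK addrC (fring_mul_pos_part a b) subrK.
      by apply: fring_addr_ge0; apply: fring_mulr_ge0.
    (* If both parts of [a] were in [T], so would be their product, which is zero. *)
    - move=> a; apply: contrapT => /not_orP[/contrapT T1 /contrapT T2'].
      by have := TM _ _ (p0 _) (p0 _) T1 T2'; rewrite pos_partM0.
    - move=> a b Na Nb Nab; apply: contrapT => /not_orP[Ta Tb].
      move: Nab Ta Tb; rewrite /N /= !opprK => Nab /contrapT Ta /contrapT Tb.
      have papb : 0 <= lmul (pos_part a) (pos_part b) by apply: fring_mulr_ge0.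
      have := TM _ _ (p0 _) (p0 _) Ta Tb; rewrite -(ge0_pos_part papb).
      (* Here the bound is $a^+b^+ \le (ab)^+ + a^+b^- + a^-b^+$. *)
      apply: (pN _ _ [:: pos_part (lmul a b); pos_part (- a);
                         pos_part (- b)]) => //.
        move=> J radJ abJ.
        exists (pos_part (lmul a b) + (lmul (pos_part a) (pos_part (- b)) +
          lmul (pos_part (- a)) (pos_part b))).
          apply: (l_idealD radJ); first by apply: abJ; rewrite mem_head.
          by apply: (l_idealD radJ);
            [apply: (l_idealMl radJ.1) | apply: (l_idealMr radJ.1)];
            apply: abJ; rewrite !inE eqxx ?orbT.
        apply: (@le_trans _ _ (lmul a b + (lmul (pos_part a) (pos_part (- b)) +
          lmul (pos_part (- a)) (pos_part b)))); last first.
          by apply: leD; rewrite ?lexx // pos_part_ge.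
        rewrite (fring_mul_pos_part a b) subrK -fring_subr_ge0.
        by rewrite addrAC subrr add0r; apply: fring_mulr_ge0.
      by move=> c; rewrite inE => /orP[/eqP ->//|]; apply: T2.
    (* The top of the lattice contains [s], so one of the generators of its ideal lies in [T], and
       so does its positive or its negative part. *)
    - have [x gx] := gK (SetLattice (punctured1 chK)).
      have [//|b _ /T_pos[Tb|Tb]] := T_gen _ _ gx.
        by exists (- b); rewrite /N /= opprK.
      by exists b.
  have satN x : sat N x <-> set_lattice_val x s.
    split=> [[a xa]|xs].
      rewrite /N /= opprK => /contrapT[y gy ys]; apply: val_le ys; rewrite gy.
      apply: gen_sub => // b; rewrite mem_seq1 => /eqP ->.
      exact: (l_ideal_pos (radg x) xa).
    have [l gx] := gK x; have [a al /T_pos[Ta|Ta]] := T_gen _ _ gx xs.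
      by exists a; rewrite ?gx /N /= ?opprK; [exact: mem_gen|apply].
    exists (- a); last by rewrite /N /= opprK => /(_ Ta).
    by apply: (l_idealN (radg x)); rewrite gx; apply: mem_gen.
  exists N => //; split=> // a /ge0_pos_partN; rewrite /N /= => ->.
  exact: T0.
(* The positivity locus of [a] is the ideal generated by $a^+$, because $a > 0$ along a cone exactly
   when $a^+$ is off the support. *)
- move=> a; have [x gx] := g_onto [:: pos_part a]; exists x.
  move=> N [coneN N0]; split=> [[b xb Nb] Na|Na].
    apply: Nb; rewrite gx in xb.
    have [] // := gen_sub (radical_l_ideal_supp coneN N0) _ xb.
    by move=> c; rewrite mem_seq1 => /eqP ->; apply: rng_cone_pos_part.
  exists (pos_part a); first by rewrite gx; apply: mem_gen; rewrite mem_head.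
  move=> Npa; apply: Na; rewrite -(pos_partB a) opprB addrC.
  by apply: (rng_coneD coneN) => //; apply/N0/pos_part_ge0.
- by move=> N x y _ /g_le xy [a /xy ya Na]; exists a.
- move=> N x y [coneN _] [a xa Na] [b yb Nb].
  have [z gz] := g_onto [:: lmul a b].
  exists (lmul a b).
    have /g_le : (z <= x `&` y)%O.
      rewrite lexI; apply/andP; split; apply/g_le; rewrite gz;
        apply: gen_sub => // c; rewrite mem_seq1 => /eqP ->.
        exact: (l_idealMr (radg _).1).
      exact: (l_idealMl (radg _).1).
    by apply; rewrite gz; apply: mem_gen; rewrite mem_head.
  have [Na' Nb'] := (rng_cone_pos coneN Na, rng_cone_pos coneN Nb).
  by move=> /(rng_cone_prime coneN Na' Nb')[].
- by move=> M N x _ _ MN [a xa Na]; exists a => // /MN.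
Qed.

(** * The first uncountable ordinal *)

Lemma uncountable_set_nat : ~ countable [set: set nat].
Proof.
move=> /countable_injP[f f_inj].
pose D : set nat := [set n | exists2 B : set nat, f B = n & ~ B n].
have nD : ~ D (f D).
  by move=> DfD; have [B fB] := DfD; rewrite (f_inj B D) ?inE.
by apply: (nD); exists D.
Qed.

(** Reflexivity, totality, antisymmetry and transitivity are read off the unique minima of sets of
    at most three elements. *)
Lemma well_order_strict (T : eqType) (R : rel T) : well_order R ->
  [/\ well_founded (fun x y => R x y /\ x <> y),
      forall x y, x <> y -> (R x y /\ x <> y) \/ (R y x /\ y <> x)
    & forall x y z, R x y /\ x <> y -> R y z /\ y <> z -> R x z /\ x <> z].
Proof.
move=> wo.
have minl (s : seq T) x : x \in s ->
    exists2 z, z \in s & forall y, y \in s -> R z y.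
  by move=> xs; have [|z [[zs zP] _]] := wo [in s]; [exists x | exists z].
have minset (A : set T) x : A x -> exists2 z, A z & forall y, A y -> R z y.
  move=> Ax; have [|z [[/asboolP Az zP] _]] := wo [pred y | `[< A y >]].
    by exists x; apply/asboolP.
  by exists z => // y Ay; apply: zP; apply/asboolP.
have refl x : R x x.
  have [z] := minl [:: x] x (mem_head _ _); rewrite mem_seq1 => /eqP ->.
  by apply; rewrite mem_head.
have tot x y : R x y \/ R y x.
  have [z] := minl [:: x; y] x (mem_head _ _).
  by rewrite !inE => /orP[] /eqP -> zP; [left|right]; apply: zP;
    rewrite !inE eqxx ?orbT.
have anti x y : R x y -> R y x -> x = y.
  move=> Rxy Ryx; have [|z [_ zU]] := wo [in [:: x; y]].
    by exists x; rewrite mem_head.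
  have minz t : t \in [:: x; y] -> R t x -> R t y -> z = t.
    move=> txy tx ty; apply: zU; split=> // u.
    by rewrite [u \in _]inE mem_seq1 => /orP[] /eqP ->.
  have zx := minz x (mem_head _ _) (refl x) Rxy.
  by rewrite -zx; apply: minz; rewrite // !inE eqxx orbT.
have trans x y z : R x y -> R y z -> R x z.
  move=> Rxy Ryz; have [t] := minl [:: x; y; z] x (mem_head _ _).
  rewrite !inE => /or3P[] /eqP -> tP.
  - by apply: tP; rewrite !inE eqxx ?orbT.
  - by rewrite -(anti y x) //; apply: tP; rewrite !inE eqxx ?orbT.
  by rewrite -(anti y z) //; apply: tP; rewrite !inE eqxx ?orbT.
split.
- move=> x; apply: contrapT => /(minset (fun y => ~ Acc _ y))[z nacc zP].
  apply: nacc; constructor => y [Ryz yz]; apply: contrapT => /zP Rzy.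
  by apply: yz; apply: anti.
- by move=> x y xy; case: (tot x y) => ?; [left|right]; split=> // /esym.
move=> x y z [Rxy xy] [Ryz _]; split; first exact: trans Ryz.
by move=> xz; apply: xy; apply: anti => //; rewrite xz.
Qed.

(** Well-order the subsets of [nat] and keep the elements below every element with an uncountable
    initial segment. What remains is everything, or contains the segment of the least such element;
    it is uncountable in both cases. *)
Lemma exists_omega1 : exists (W : choiceType) (lt : W -> W -> Prop),
  [/\ well_founded lt, forall x y, x <> y -> lt x y \/ lt y x,
      forall x y z, lt x y -> lt y z -> lt x z,
      forall x, countable [set y | lt y x] & ~ countable [set: W]].
Proof.
have [R wo] := well_ordering_principle (set nat).
have [wf tot tr] := well_order_strict wo.
pose lt (x y : set nat) := R x y /\ x <> y.
pose bad : set (set nat) := [set x | ~ countable [set y | lt y x]].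
pose W := [set y | forall x, bad x -> lt y x].
have segW x : W x -> countable [set y | lt y x].
  move=> Wx; apply: contrapT => /Wx[_]; exact.
have unW : ~ countable W.
  have [[x badx]|nobad] := pselect (exists x, bad x); last first.
    move=> cW; apply: uncountable_set_nat; apply: sub_countable cW.
    by apply: subset_card_le => y _ x badx; case: nobad; exists x.
  have [z [badz zP]] : exists z, bad z /\ forall y, lt y z -> ~ bad y.
    elim: (wf x) badx => {}x _ ih badx.
    have [[y yx bady]|none] := pselect (exists2 y, lt y x & bad y).
      exact: (ih y).
    by exists x; split=> // y yx bady; apply: none; exists y.
  apply: contra_not badz; apply: sub_countable.
  apply: subset_card_le => y yz t badt.
  have [<- //|zt] := eqVneq z t.
  case: (tot z t) => [|zt'|/zP]; [exact/eqP| |by []].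
  exact: tr zt'.
exists W, (fun x y => lt (set_val x) (set_val y)); split.
- suff accP t (x : W) : set_val x = t ->
      Acc (fun x y : W => lt (set_val x) (set_val y)) x.
    by move=> x; apply: accP.
  elim: (wf t) x => {}t _ ih x xt; constructor => y yx.
  by apply: (ih (set_val y)) => //; rewrite -xt.
- by move=> x y xy; apply: tot => /val_inj.
- by move=> x y z; apply: tr.
- move=> x; have := segW _ (set_valP x); apply: sub_countable.
  rewrite -(card_le_eql (inj_card_eq (f := set_val) _)); last first.
    by move=> y z _ _ /val_inj.
  by apply: subset_card_le => _ [y yx <-].
by rewrite (eq_countable (card_setT W)).
Qed.

(** * Sets that embed in every uncountable set *)

Section CountableSegments.
Variables (T : Type) (lt : T -> T -> Prop).
Hypothesis lt_wf : well_founded lt.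
Hypothesis lt_total : forall x y, x <> y -> lt x y \/ lt y x.
Hypothesis lt_countable : forall x, countable [set y | lt y x].

(** Transfinite recursion: the value at [x] is chosen outside the countable set of the values taken
    below [x]. *)
Lemma countable_segments_card_le (U : Type) :
  ~ countable [set: U] -> [set: T] #<= [set: U].
Proof.
move=> unU.
(* The element [e S] avoids [S] when [S] is countable and is arbitrary otherwise. *)
have /choice[e eP] : forall S : set U, exists u, countable S -> ~ S u.
  move=> S; have [cS|] := pselect (countable S); last first.
    have [u] : exists u : U, True.
      apply: contrapT => noU; apply: unU; rewrite (_ : [set: U] = set0) //.
      by apply/seteqP; split=> // u _; apply: noU; exists u.
    by exists u.
  apply: contrapT => full; apply: unU; apply: sub_countable cS.
  apply: subset_card_le => u _; apply: contrapT => Su; apply: full.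
  by exists u.
pose F x (rec : forall y, lt y x -> U) := e [set u | exists y h, rec y h = u].
pose f := Fix lt_wf (fun=> U) F.
have fE x : f x = e [set f y | y in [set y | lt y x]].
  rewrite {1}/f Fix_eq; last first.
    move=> y g h gh; rewrite /F; congr e; apply/seteqP; split=> u [z [zy <-]];
      by exists z, zy.
  rewrite /F; congr e; apply/seteqP; split=> u.
    by move=> [y [yx <-]]; exists y.
  by move=> [y yx <-]; exists y, yx.
have f_neq x y : lt y x -> f y <> f x.
  move=> yx fyx; have := fE x; set S := image _ _ => fxS.
  have : ~ S (e S).
    apply: eP; apply: sub_countable (lt_countable x); exact: card_image_le.
  by apply; rewrite -fxS -fyx; exists y.
have f_inj : injective f.
  move=> x y fxy; apply: contrapT => /lt_total[/f_neq|/f_neq]; apply => //.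
rewrite -(card_le_eql (inj_card_eq (in2W f_inj))); exact: card_leT.
Qed.

End CountableSegments.

(** Order [T] lexicographically, by rank and then by an enumeration of the fiber: its initial
    segments are countable. *)
Lemma countable_fibers_card_le (T W : Type) (lt : W -> W -> Prop)
    (rank : T -> W) (U : Type) :
  well_founded lt -> (forall x y, x <> y -> lt x y \/ lt y x) ->
  (forall x, countable [set y | lt y x]) ->
  (forall w, countable [set t | rank t = w]) ->
  ~ countable [set: U] -> [set: T] #<= [set: U].
Proof.
move=> wf tot seg fib.
have /choice[idx idxP] : forall w, exists f : T -> nat,
    forall s t, rank s = w -> rank t = w -> f s = f t -> s = t.
  move=> w; have /countable_injP[f f_inj] := fib w; exists f => s t sw tw.
  by apply: f_inj; rewrite inE.
pose ix t := idx (rank t) t.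
pose ltT s t := lt (rank s) (rank t) \/ rank s = rank t /\ (ix s < ix t)%N.
apply: (@countable_segments_card_le T ltT).
- suff accP w t : rank t = w -> Acc ltT t by move=> t; apply: accP.
  elim: (wf w) t => {}w _ ihw t tw.
  have [n tn] : exists n, (ix t < n)%N by exists (ix t).+1.
  elim: n t tw tn => [t _|n ihn t tw tn]; first by rewrite ltn0.
  constructor => s [st|[st ist]]; first by apply: (ihw (rank s)); rewrite -?tw.
  by apply: ihn; rewrite ?st // (leq_trans ist).
- move=> s t st; have [rst|/tot[]] := pselect (rank s = rank t); first last.
    by right; left.
  + by left; left.
  have : ix s <> ix t.
    move=> ixst; apply: st; apply: (idxP (rank t)) => //.
    by move: ixst; rewrite /ix rst.
  by move/eqP; rewrite neq_ltn => /orP[ist|ist]; [left|right]; right.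
move=> t; pose D := [set w | lt w (rank t)] `|` [set rank t].
have cD : countable D.
  have -> : D = \bigcup_b (if b then [set w | lt w (rank t)] else [set rank t]).
    by apply/seteqP; split=> w [];
      [exists true|exists false|move=> [] _; [left|right]].
  apply: bigcup_countable => [|[] _]; [exact: countableP|exact: seg|].
  exact: countable1.
have : countable (\bigcup_(w in D) [set s | rank s = w]).
  by apply: bigcup_countable.
apply: sub_countable; apply: subset_card_le => s [st|[st _]].
  by exists (rank s) => //; left.
by exists (rank s) => //; right.
Qed.

(** * Almost constant functions into Z[x][y] *)

(** The nonnegative elements of a total ring order, that is, a cone with zero support. *)
Record strict_cone (R : comPzRingType) (C : set R) : Prop := {
  strict_coneD : forall x y, C x -> C y -> C (x + y);
  strict_coneM : forall x y, C x -> C y -> C (x * y);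
  strict_cone_total : forall x, C x \/ C (- x);
  strict_cone_anti : forall x, C x -> C (- x) -> x = 0;
}.

Lemma strict_cone0 (R : comPzRingType) (C : set R) : strict_cone C -> C 0.
Proof. by move=> sC; case: (strict_cone_total sC 0); rewrite ?oppr0. Qed.

Lemma strict_prime_cone (R : idomainType) (C : set R) :
  strict_cone C -> prime_cone C.
Proof.
move=> [CD CM CT Ca].
have CN1 : ~ C (-1).
  move=> CN1; have C1 : C 1 by rewrite -[1]mulr1 -mulrNN; apply: CM.
  by have /eqP := Ca _ C1 CN1; rewrite oner_eq0.
apply: rng_cone_prime_cone => //; split=> //; last by exists (-1).
move=> x y Cx Cy /(Ca _ (CM _ _ Cx Cy))/eqP.
by rewrite mulf_eq0 => /orP[] /eqP x0; [left|right];
  rewrite x0 oppr0; apply: strict_cone0; split.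
Qed.

Lemma strict_cone_int : strict_cone [set z : int | 0 <= z].
Proof.
split=> /=; [exact: addr_ge0|exact: mulr_ge0| |].
- by move=> x; rewrite oppr_ge0; apply/orP; apply: le_total.
- by move=> x x0; rewrite oppr_ge0 => x0'; apply/eqP; rewrite eq_le x0 x0'.
Qed.

(** * Ordering polynomials by their lowest coefficient *)

Section LowestCoefficient.
Variables (R : idomainType) (C : set R).
Hypothesis sC : strict_cone C.

Definition low_pos (p : {poly R}) :=
  exists k q, [/\ p = q * 'X^k, q`_0 != 0 & C q`_0].

Definition low_cone : set {poly R} := [set p | p = 0 \/ low_pos p].

Lemma low_pos_neq0 p : low_pos p -> p != 0.
Proof.
move=> [k [q [-> q0 _]]]; rewrite mulf_neq0 ?expf_neq0 ?polyX_eq0 //.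
by apply: contraNneq q0 => ->; rewrite coef0.
Qed.

Lemma low_posD p r : low_pos p -> low_pos r -> low_pos (p + r).
Proof.
move=> [k [q [-> q0 Cq]]] [l [s [-> s0 Cs]]].
wlog kl : k l q s q0 s0 Cq Cs / (k <= l)%N => [wl|].
  case/orP: (leq_total k l) => kl; first exact: wl.
  by rewrite addrC; apply: wl.
exists k, (q + s * 'X^(l - k)); split.
- by rewrite mulrDl -mulrA -exprD subnK.
- rewrite coefD coefMXn; case: ifP => _; first by rewrite addr0.
  rewrite sub0n; apply/eqP => /eqP; rewrite addrC addr_eq0 => /eqP sq.
  by case/eqP: q0; apply: (strict_cone_anti sC) => //; rewrite -sq.
- rewrite coefD coefMXn; case: ifP => _; first by rewrite addr0.
  by rewrite sub0n; apply: (strict_coneD sC).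
Qed.

Lemma strict_cone_low : strict_cone low_cone.
Proof.
split.
- move=> p r [->|pp]; first by rewrite add0r.
  by move=> [->|rr]; [rewrite addr0; right | right; apply: low_posD].
- move=> p r [->|[k [q [-> q0 Cq]]]]; first by rewrite mul0r; left.
  move=> [->|[l [s [-> s0 Cs]]]]; first by rewrite mulr0; left.
  right; exists (k + l)%N, (q * s); rewrite coef0M mulf_neq0 //; split=> //.
    by rewrite mulrACA -exprD.
  exact: (strict_coneM sC).
- move=> p; have [->|p0] := eqVneq p 0; first by left; left.
  (* Dividing by the full power of ['X] exposes the lowest coefficient. *)
  have [k [q rq pE]] := multiplicity_XsubC p 0.
  rewrite p0 /= /root horner_coef0 subr0 in rq pE.
  case: (strict_cone_total sC q`_0) => Cq; [left|right]; right.
    by exists k, q.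
  by exists k, (- q); rewrite mulNr -pE coefN oppr_eq0.
- move=> p [//|pp] [/eqP|pn]; first by rewrite oppr_eq0 => /eqP.
  by have := low_pos_neq0 (low_posD pp pn); rewrite subrr eqxx.
Qed.

Lemma low_cone_coef0 p : low_cone p -> C p`_0.
Proof.
move=> [->|[k [q [-> _ Cq]]]]; first by rewrite coef0; apply: strict_cone0.
by rewrite coefMXn; case: ifP => // _; apply: strict_cone0.
Qed.

Lemma low_coneX : C 1 -> ~ low_cone (- 'X).
Proof.
move=> C1 XN; have Xp : low_cone 'X.
  by right; exists 1%N, 1; rewrite mul1r expr1 coef1 oner_neq0.
by have /eqP := strict_cone_anti strict_cone_low Xp XN; rewrite polyX_eq0.
Qed.

End LowestCoefficient.

Lemma prime_cone_preimage (R S : comPzRingType) (f : R -> S) (P : set S) :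
  f 1 = 1 -> {morph f : x y / x + y} -> {morph f : x y / x * y} ->
  prime_cone P -> prime_cone (f @^-1` P).
Proof.
move=> f1 fD fM primeP; have [PD PM PT PP _] := prime_cone_rng_cone primeP.
have f0 : f 0 = 0 by apply: (addrI (f 0)); rewrite -fD !addr0.
have fN x : f (- x) = - f x by apply: (addrI (f x)); rewrite -fD !subrr.
have PN1 : ~ P (f (-1)) by rewrite fN f1; apply: prime_coneN1.
apply: rng_cone_prime_cone => //; split.
- by move=> x y; rewrite /= fD; apply: PD.
- by move=> x y; rewrite /= fM; apply: PM.
- by move=> x; rewrite /= fN; apply: PT.
- by move=> x y; rewrite /= !fN fM; apply: PP.
- by exists (-1).
Qed.

(** * The ring of almost constant functions and the cardinality of its lattice *)

Section AlmostConstant.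
Variable W : choiceType.
Local Notation V := {poly {poly int}}.

Definition almost_constant : pred (option W -> V) :=
  [pred f | `[< finite_set [set w | f (Some w) <> f None] >]].

Lemma almost_constant_subring : subring_closed almost_constant.
Proof.
have fin2 (f g h : option W -> V) :
    f \in almost_constant -> g \in almost_constant ->
    (forall w, f (Some w) = f None -> g (Some w) = g None ->
       h (Some w) = h None) -> h \in almost_constant.
  move=> /asboolP fin_f /asboolP fin_g fgh; apply/asboolP.
  apply: sub_finite_set (_ : finite_set (_ `|` _)); last first.
    by rewrite finite_setU; split; [exact: fin_f | exact: fin_g].
  move=> w /= hw; apply: contrapT => /not_orP[/contrapT fw /contrapT gw].
  exact/hw/fgh.
split.
- by apply/asboolP; rewrite (_ : [set _ | _] = set0) //; apply/seteqP; split.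
- move=> f g ff gf; apply: (fin2 f g) => // w fw gw.
  by rewrite !fctE fw gw.
- move=> f g ff gf; apply: (fin2 f g) => // w fw gw.
  by rewrite !fctE fw gw.
Qed.

Record ac_ring := ACRing { ac_val :> option W -> V;
  ac_valP : ac_val \in almost_constant }.
HB.instance Definition _ := [isSub for ac_val].
HB.instance Definition _ := [Choice of ac_ring by <:].
HB.instance Definition _ := GRing.SubChoice_isSubComPzRing.Build
  (option W -> V) almost_constant ac_ring almost_constant_subring.

(** A code gives the limit value and the values at the indices in [l]. Truncating to [size l] sends
    any index outside [l] past the end of the list, to the default, which is the limit value. *)
Definition ac_decode (l : seq W) (c : V * seq V) (o : option W) : V :=
  if o is Some w then nth c.1 (take (size l) c.2) (index w l) else c.1.

Lemma ac_decode_subproof l c : ac_decode l c \in almost_constant.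
Proof.
apply/asboolP; apply: sub_finite_set (finite_seq l) => w /= wP.
apply: contrapT => /negP wl; apply: wP; rewrite nth_default //.
by rewrite memNindex // size_take_min geq_minl.
Qed.

Definition ac_of l c : ac_ring := ACRing (ac_decode_subproof l c).

Lemma ac_ofP (f : ac_ring) (l : seq W) :
  (forall w, w \notin l -> f (Some w) = f None) ->
  f = ac_of l (f None, [seq f (Some w) | w <- l]).
Proof.
move=> fl; apply/val_inj/funext => -[w|] //=.
rewrite take_oversize ?size_map //; have [wl|wl] := boolP (w \in l).
  by rewrite (nth_map w) ?index_mem // nth_index.
by rewrite nth_default ?size_map ?memNindex // fl.
Qed.

Lemma ac_supp (ss : seq (ac_ring)) : exists l : seq W,
  forall f w, f \in ss -> w \notin l -> f (Some w) = f None.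
Proof.
elim: ss => [|f ss [l lP]]; first by exists [::].
have /asboolP/finite_seqP[k kP] := ac_valP f; exists (k ++ l) => g w.
rewrite inE mem_cat negb_or => /orP[/eqP -> /andP[wk _]|gs /andP[_ wl]].
  by apply: contrapT => fw; case/negP: wk; have : [set` k] w by rewrite -kP.
exact: lP.
Qed.

Local Notation Sper := (real_spectrum ac_ring).
Local Notation E := (set_lattice (compact_open_ring ac_ring)).

Definition finitary_elt (ss : seq (seq ac_ring)) : E :=
  @SetLattice _ (compact_open_ring ac_ring) (finitary_open ss)
    ((compact_openP _).2 (ex_intro _ ss erefl)).

Lemma finitary_elt_surj (x : E) : exists ss, x = finitary_elt ss.
Proof.
have [ss ssE] := (compact_openP _).1 (set_latticeP x).
by exists ss; apply: set_lattice_inj.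
Qed.

(** One list of indices serves all functions involved; the rest of the code lies in a countable
    type. *)
Definition elt_of (c : seq W * seq (seq (V * seq V))) : E :=
  finitary_elt (map (map (ac_of c.1)) c.2).

Lemma elt_of_surj : range elt_of = [set: E].
Proof.
apply/seteqP; split=> // x _; have [ss ->] := finitary_elt_surj x.
have [l lP] := ac_supp (flatten ss).
pose c (f : ac_ring) := (f None, [seq f (Some w) | w <- l]).
exists (l, map (map c) ss) => //; rewrite /elt_of /=; congr finitary_elt.
rewrite -map_comp -[RHS]map_id; apply/eq_in_map => s s_ss.
rewrite /= -map_comp -[RHS]map_id; apply/eq_in_map => f fs.
by rewrite /= -ac_ofP // => w; apply: lP; apply/flattenP; exists s.
Qed.

(** Rank a code by an upper bound of its indices. The codes of rank [w] are built from the countably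
    many indices up to [w] and countable data, so the fibers are countable. *)
Lemma card_elt_le (lt : W -> W -> Prop) (w0 : W) (U : Type) :
  well_founded lt -> (forall x y, x <> y -> lt x y \/ lt y x) ->
  (forall x y z, lt x y -> lt y z -> lt x z) ->
  (forall x, countable [set y | lt y x]) ->
  ~ countable [set: U] -> [set: E] #<= [set: U].
Proof.
move=> wf tot tr seg unU; pose C := (seq W * seq (seq (V * seq V)))%type.
apply: (@card_le_trans _ C _ [set: C]).
  by rewrite -elt_of_surj; apply: card_image_le.
have /choice[rank rankP] : forall c : C, exists w, forall x, x \in c.1 ->
    ~ lt w x.
  move=> [l c] /=; elim: l => [|x l [w wP]]; first by exists w0.
  have ltxx y : ~ lt y y by elim: (wf y) => {}y _ ih yy; apply: (ih y).
  have [wx|wx] := pselect (lt w x); [exists x | exists w] => y;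
    rewrite inE => /orP[/eqP ->//|/wP wy] => // xy; exact/wy/(tr _ x).
apply: (countable_fibers_card_le (rank := rank) wf tot seg) => // w.
pose D := [set x | lt x w] `|` [set w].
have : countable D.
  have -> : D = \bigcup_b (if b then [set x | lt x w] else [set w]).
    by apply/seteqP; split=> x [];
      [exists true|exists false|move=> [] _; [left|right]].
  apply: bigcup_countable => [|[] _]; [exact: countableP|exact: seg|].
  exact: countable1.
move=> /countable_injP[j j_inj].
have rankD c x : rank c = w -> x \in c.1 -> D x.
  move=> cw /rankP; rewrite cw => wx.
  by have [<-|/tot[]] := pselect (w = x); [right| |left].
apply/countable_injP.
exists (fun c : C => choice.pickle (map j c.1, c.2)) => -[l c] [l' c'].
rewrite !inE /= => lw lw' /(pcan_inj choice.pickleK)[jl ->]; congr pair.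
have {lw}lD x : x \in l -> D x by apply: (rankD (l, c)).
have {lw'}lD' x : x \in l' -> D x by apply: (rankD (l', c')).
elim: l l' jl lD lD' {c c'} => [|x l ih] [|x' l'] //= [jx jl] lD lD'.
congr cons.
  by apply: j_inj => //; rewrite inE; [apply: lD | apply: lD'];
    rewrite mem_head.
apply: ih => // y yl; [apply: lD | apply: lD']; by rewrite inE yl orbT.
Qed.

End AlmostConstant.

(** * The chosen points of the real spectrum *)

Section ChainPoints.
Variable W : choiceType.
Local Notation V := {poly {poly int}}.
Local Notation R := (ac_ring W).
Local Notation Sper := (real_spectrum R).

Let nonneg_int : set int := [set z | 0 <= z].

(* The three nested prime cones of [Z[x][y]] with [y] infinitely smaller than
   the infinitesimal [x]; their supports are [0], [(y)] and [(x, y)]. *)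
Definition chain_cone (i : nat) : set V :=
  match i with
  | 0 => low_cone (low_cone nonneg_int)
  | 1 => [set v : V | low_cone nonneg_int v`_0]
  | _ => [set v : V | nonneg_int v`_0`_0]
  end.

Let strict1 := strict_cone_low strict_cone_int.
Let strict0 := strict_cone_low strict1.

Lemma chain_cone_prime i : prime_cone (chain_cone i).
Proof.
case: i => [|[|i]] /=; first exact: strict_prime_cone strict0.
  apply: (prime_cone_preimage (f := fun v : V => v`_0)) => //.
  - by rewrite coefC.
  - by move=> u v; rewrite coefD.
  - by move=> u v; rewrite coef0M.
  exact: strict_prime_cone strict1.
apply: (prime_cone_preimage (f := fun v : V => v`_0`_0)).
- by rewrite !coefC.
- by move=> u v; rewrite !coefD.
- by move=> u v; rewrite !coef0M.
exact: strict_prime_cone strict_cone_int.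
Qed.

Lemma chain_cone01 : chain_cone 0 `<=` chain_cone 1.
Proof. by move=> v; apply: low_cone_coef0. Qed.

Lemma chain_cone12 : chain_cone 1 `<=` chain_cone 2.
Proof. by move=> v; apply: (low_cone_coef0 strict_cone_int). Qed.

Lemma chain_cone_at o i :
  prime_cone [set f : R | chain_cone i (f o)].
Proof.
by apply: (prime_cone_preimage (f := fun f : R => f o)) (chain_cone_prime i).
Qed.

Definition cone_at o i : Sper := exist _ _ (chain_cone_at o i).

Definition point_cone (s : chain_point W) : Sper :=
  match s with
  | Base0 => cone_at None 0
  | Base1 => cone_at None 1
  | Base2 => cone_at None 2
  | Copy0 w => cone_at (Some w) 0
  | Copy2 w => cone_at (Some w) 2
  end.

Definition chain_trace := trace_ring point_cone (compact_open_ring R).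

(** A compact open set involves finitely many functions, all of which take their limit value outside
    a finite set of indices. *)
Lemma finitary_open_ae (U : set Sper) i : compact_opens U ->
  countable [set w | ~ (U (cone_at (Some w) i) <-> U (cone_at None i))].
Proof.
move=> /compact_openP[ss ->]; have [l lP] := ac_supp (flatten ss).
apply: sub_countable (finite_set_countable (finite_seq l)).
apply: subset_card_le => w nw /=; apply: contrapT => /negP wl; apply: nw.
have eqw f s : s \in ss -> f \in s -> f (Some w) = f None.
  by move=> s_ss fs; apply: lP => //; apply/flattenP; exists s.
by split=> -[s s_ss sP]; exists s => // f fs /=; have := sP f fs;
  rewrite /= (eqw f s).
Qed.

Definition ac_const (v : V) : R := @ac_of W [::] (v, [::]).
Definition ac_indic (w : W) : R := ac_of [:: w] (0, [:: 1]).

Lemma pos_open_cone_at f o i :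
  pos_open f (cone_at o i) <-> ~ chain_cone i (- f o).
Proof. by []. Qed.

Lemma chain_trace_punctured : punctured_chains chain_trace.
Proof.
have traceP U : compact_opens U -> chain_trace (point_cone @^-1` U).
  by move=> cU; exists U.
have gen (U : set Sper) o i j : compact_opens U ->
    chain_cone i `<=` chain_cone j -> U (cone_at o j) -> U (cone_at o i).
  by move=> cU ij; apply: compact_open_gen => // f; apply: ij.
have nonneg0 : nonneg_int 0 by exact: lexx.
have low0 : low_cone nonneg_int 0 by left.
split.
- exists set0 => //; apply/compact_openP; exists [::].
  by apply/seteqP; split=> P [].
- exists setT => //; apply/compact_openP; exists [:: [::]].
  by apply/seteqP; split=> // P _; exists [::].
- by move=> _ [U cU <-]; apply: gen chain_cone01.
- by move=> _ [U cU <-]; apply: gen chain_cone12.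
- move=> _ w [U cU <-]; apply: gen => //.
  exact: subset_trans chain_cone01 chain_cone12.
- by move=> _ [U cU <-]; apply: finitary_open_ae.
- by move=> _ [U cU <-]; apply: finitary_open_ae.
(* The outer variable ['X] is $y$, positive at [Base0] and zero at [Base1]. *)
- exists (point_cone @^-1` pos_open (ac_const 'X)); split.
  + exact/traceP/compact_open_pos.
  + apply/pos_open_cone_at/low_coneX; first exact: strict1.
    by right; exists 0%N, 1; rewrite mulr1 coefC oner_neq0.
  + by move/pos_open_cone_at; apply; rewrite /= coefN coefX oppr0.
(* The inner variable ['X%:P] is $x$, positive at [Base1] and zero at [Base2]. *)
- exists (point_cone @^-1` pos_open (ac_const 'X%:P)); split.
  + exact/traceP/compact_open_pos.
  + apply/pos_open_cone_at; rewrite /= coefN coefC /=.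
    exact: low_coneX strict_cone_int _.
  + by move/pos_open_cone_at; apply; rewrite /= !coefN coefC /= coefX oppr0.
(* The indicator function of [w] equals 1 at [w] and 0 elsewhere, so it is positive exactly at the
   points above [w]. *)
move=> w; exists (point_cone @^-1` pos_open (ac_indic w)); split.
  exact/traceP/compact_open_pos.
have at_w i : ~ chain_cone i (- ac_indic w (Some w)).
  rewrite /= eqxx /=; exact: prime_coneN1 (chain_cone_prime i).
have off_w o i : o <> Some w -> chain_cone i (- ac_indic w o).
  move=> ow; rewrite (_ : ac_indic w o = 0); last first.
    case: o ow => [v|//] /= vw; case: eqP => [wv|//].
    by case: vw; rewrite wv.
  by rewrite oppr0; apply: cone0 (prime_cone_cone (chain_cone_prime i)).
move=> s; split; last by case=> ->; apply: at_w.
move=> sP; have at_w_only o i : point_cone s = cone_at o i -> o = Some w.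
  move=> so; apply: contrapT => /(off_w _ i).
  by apply: (pos_open_cone_at _ _ _).1; rewrite -so.
case: s {sP} at_w_only => [| | |v|v] at_w_only.
- by have := at_w_only _ 0%N erefl.
- by have := at_w_only _ 1%N erefl.
- by have := at_w_only _ 2%N erefl.
- by have [->] := at_w_only _ 0%N erefl; left.
- by have [->] := at_w_only _ 2%N erefl; right.
Qed.

(** The sets isolating the points above each index embed [W] in the lattice. *)
Lemma uncountable_elt : ~ countable [set: W] ->
  ~ countable [set: set_lattice (compact_open_ring R)].
Proof.
move=> unW cE; apply: unW; apply: sub_countable cE.
have /choice[Z ZP] := punctured_copy chain_trace_punctured.
have /choice[U UP] : forall w, exists U : set_lattice (compact_open_ring R),
    point_cone @^-1` set_lattice_val U = Z w.
  move=> w; have [[U cU UZ] _] := ZP w.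
  by exists (@SetLattice _ (compact_open_ring R) U cU).
have U_inj : injective U.
  move=> w v Uwv; have : Z v (Copy0 w).
    by rewrite -UP -Uwv UP; apply/(ZP w).2; left.
  by move=> /(ZP v).2[[]|].
by rewrite -(card_le_eql (inj_card_eq (in2W U_inj))); apply: card_leT.
Qed.

End ChainPoints.

Theorem theorem5p9 :
  exists (d : Order.disp_t) (E : distrLatticeType d),
    [/\ real_representable E,
        has_cardinality_aleph1 E
      & exists (d' : Order.disp_t) (L : latticeType d')
               (f : Order.LatticeMorphism.type E L),
          [/\ range f = [set: L],
              ~ brumfiel_representable L
            & ~ real_representable L]].
Proof.
have [W [lt [wf tot tr seg unW]]] := exists_omega1.
(* The element [w0] serves as the rank of the empty list of indices in [card_elt_le]. *)
have [w0] : exists w : W, True.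
  apply: contrapT => noW; apply: unW; rewrite (_ : [set: W] = set0) //.
  by apply/seteqP; split=> // w _; apply: noW; exists w.
pose E := set_lattice (compact_open_ring (ac_ring W)).
have chL := chain_trace_punctured W.
exists Order.default_display, E; split.
- by exists (ac_ring W); apply: set_lattice_isomorphic.
- split; first exact: uncountable_elt.
  by move=> U unU; apply: (card_elt_le w0 wf tot tr seg unU).
exists Order.default_display, (set_lattice (chain_trace W)).
exists (trace (@point_cone W) (K := compact_open_ring (ac_ring W))); split.
- exact: trace_surj.
- exact: punctured_chains_not_brumfiel.
- exact: punctured_chains_not_real.
Qed.
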